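(* Let $m\ge1$ and let $(\Gamma_n,S_n)_{n\ge1}$ be a sequence of marked groups in $\Sigma_m$ converging in $\Sigma_m$ to $(\Gamma,S)$. Suppose that each $\Gamma_n$ is torsion-free and sofic and that the Atiyah Conjecture holds for each $\Gamma_n$. Then the Atiyah Conjecture holds for $\Gamma$.
   Context: Marked groups: a finitely generated marked group $(\Gamma,S)$ is a group $\Gamma$ with an ordered generating system $S=\{s_1,\dots,s_m\}$; $\Sigma_m$ is the set of marked groups with $m$ generators, with the metric $d_{\Sigma_m}((\Gamma,S),(\Gamma',S'))=2^{-R}$ if the two groups have exactly the same relations of length at most $R$ with respect to their marked generators, while some relation of length $R+1$ holds in only one of them. A limit of torsion-free marked groups is torsion-free. Sofic: for $n\ge1$, $S_n$ (symmetric group on $n$ elements) and $\#_{\rm fix}\pi$ (number of fixed points of $\pi$). A group $G$ is sofic if for every real $0<\varepsilon<1$ and every finite subset $F\subseteq G$ there exist $n\ge 1$ and a function $\phi$ from $G$ to the symmetric group on $n$ elements such that (a) $\#_{\rm fix}(\phi(e)\phi(f)\phi(ef)^{-1})\ge(1-\varepsilon)n$ for all $e,f\in F$; (b) $\phi(1)=1$; (c) $\#_{\rm fix}\phi(e)\le\varepsilon n$ for every $1\ne e\in F$. Atiyah Conjecture for a torsion-free countable group $G$: for every $d\ge1$ and every positive self-adjoint operator $\Delta\in\mathrm{Mat}_{d\times d}(\mathbb ZG)$, the number $F_\Delta(0)$ is an integer. Here $\Delta$ is viewed in $\mathrm{Mat}_{d\times d}(NG)$ acting on $[\ell^2(G)]^d$,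 where $NG$ is the group von Neumann algebra with its usual trace $\mathrm{Tr}_G$, extended by $\mathrm{Tr}_G(A)=\sum_{i}\mathrm{Tr}_G(a_{ii})$, and $F_\Delta(0)=\dim_G(\ker\Delta)$ is the trace $\mathrm{Tr}_G$ of the orthogonal projection onto $\ker\Delta$. *)

(* Defs.v *)
From HB Require Import structures.
From mathcomp Require Import all_boot all_order all_algebra all_fingroup.
From mathcomp Require Import finmap.
From mathcomp Require Import all_classical all_reals all_analysis.
From mathcomp Require Import complex.

Set Implicit Arguments.
Unset Strict Implicit.
Unset Printing Implicit Defensive.

Import Order.TTheory GRing.Theory Num.Theory.
Import numFieldNormedType.Exports.

Local Open Scope classical_set_scope.
Local Open Scope ring_scope.

(* A word in m letters and their formal inverses; the letter (i, true) stands
   for the inverse of the i-th generator.  Words need not be reduced: for every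
   R, two marked groups have the same relations of length at most R among all
   words iff they do so among reduced words, so the metric on marked groups is
   the same for both readings. *)
Definition word (m : nat) := seq ('I_m * bool).

Definition word_eval (m : nat) (G : groupType) (s : 'I_m -> G) (w : word m) : G :=
  (\prod_(l <- w) (if l.2 then (s l.1)^-1 else s l.1))%g.

Record markedGroup (m : nat) := MarkedGroup {
  marked_group :> groupType;
  marked_gen : 'I_m -> marked_group;
  marked_genP : forall g : marked_group, exists w, word_eval marked_gen w = g
}.

Definition relation_in (m : nat) (X : markedGroup m) (w : word m) : Prop :=
  word_eval (@marked_gen m X) w = 1%g.

Definition agreement_radius (m : nat) (X Y : markedGroup m) (r : nat) : Prop :=
  (forall w : word m, (size w <= r)%N -> (relation_in X w <-> relation_in Y w)) /\
  (exists2 w : word m, size w = r.+1 & ~ (relation_in X w <-> relation_in Y w)).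

(* Marked groups with the same relations are identified: their distance is 0. *)
Definition marked_dist (R : realType) (m : nat) (X Y : markedGroup m) : R :=
  if pselect (exists r, agreement_radius X Y r)
  then 2^-1 ^+ [get r | agreement_radius X Y r] else 0.

Definition torsion_free (G : groupType) : Prop :=
  forall (g : G) (n : nat), (0 < n)%N -> (g ^+ n = 1 -> g = 1)%g.

Definition num_fix (n : nat) (p : 'S_n) : nat := #|[set i : 'I_n | p i == i]%SET|.

(* The product of 'S_n composes from left to right; since inversion is an
   isomorphism onto the opposite group which preserves fixed points, the
   notion does not depend on this convention. *)
Definition sofic (R : realType) (G : groupType) : Prop :=
  forall (eps : R) (F : {fset G}), 0 < eps < 1 ->
  exists n : nat, (0 < n)%N /\ exists phi : G -> 'S_n,
    [/\ forall e f : G, e \in F -> f \in F ->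
          (1 - eps) * n%:R <= (num_fix (phi e * phi f * (phi (e * f))^-1)%g)%:R,
        phi 1%g = 1%g
      & forall e : G, e \in F -> e != 1%g -> (num_fix (phi e))%:R <= eps * n%:R].

Section ell2.
Variable R : realType.

(* Meaningful for absolutely summable families only, which is the case of the
   products of two square-summable functions. *)
Definition real_sum (T : choiceType) (f : T -> R) : R :=
  fine (\esum_(t in [set: T]) (EFin \o f)^\+ t
        - \esum_(t in [set: T]) (EFin \o f)^\- t)%E.

Definition complex_sum (T : choiceType) (f : T -> R[i]) : R[i] :=
  Complex (real_sum (fun t => complex.Re (f t)))
          (real_sum (fun t => complex.Im (f t))).

Definition ell2 (T : choiceType) : set (T -> R[i]) :=
  [set f | (\esum_(t in [set: T]) (ComplexField.Normc.normc (f t) ^+ 2)%:E < +oo)%E].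

Definition ell2_dot (T : choiceType) (f g : T -> R[i]) : R[i] :=
  complex_sum (fun t => f t * conjc (g t)).

Definition ell2n (d : nat) (T : choiceType) : set ('I_d -> T -> R[i]) :=
  [set x | forall i, ell2 (x i)].

Definition ell2n_dot (d : nat) (T : choiceType) (x y : 'I_d -> T -> R[i]) : R[i] :=
  \sum_(i < d) ell2_dot (x i) (y i).

(* Orthogonal projection onto a subspace K, used for closed K, where the
   projection of every square-summable x exists and is unique. *)
Definition orth_proj (d : nat) (T : choiceType) (K : set ('I_d -> T -> R[i]))
    (x : 'I_d -> T -> R[i]) : 'I_d -> T -> R[i] :=
  xget 0 [set p | K p /\ forall k, K k -> ell2n_dot (x - p) k = 0].

End ell2.

Definition group_ringZ (G : groupType) := {fsfun G -> int with 0}.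

Section atiyah.
Variables (R : realType) (G : groupType).

Definition delta1 : G -> R[i] := fun g => (g == 1%g)%:R.

Definition trG (a : (G -> R[i]) -> (G -> R[i])) : R[i] := ell2_dot (a delta1) delta1.

Variable d : nat.

Definition entry (A : ('I_d -> G -> R[i]) -> ('I_d -> G -> R[i])) (i j : 'I_d) :
    (G -> R[i]) -> (G -> R[i]) :=
  fun f => A (fun k => if k == j then f else 0) i.

Definition trGn (A : ('I_d -> G -> R[i]) -> ('I_d -> G -> R[i])) : R[i] :=
  \sum_(i < d) trG (entry A i i).

(* Left regular representation of ZG on functions on G. *)
Definition lconv (a : group_ringZ G) (f : G -> R[i]) : G -> R[i] :=
  fun g => \sum_(h <- finsupp a) (a h)%:~R * f (h^-1 * g)%g.

Definition mxop (D : 'M[group_ringZ G]_d) (x : 'I_d -> G -> R[i]) : 'I_d -> G -> R[i] :=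
  fun i => \sum_(j < d) lconv (D i j) (x j).

Definition self_adjoint (D : 'M[group_ringZ G]_d) : Prop :=
  forall x y, ell2n x -> ell2n y -> ell2n_dot (mxop D x) y = ell2n_dot x (mxop D y).

Definition positive_op (D : 'M[group_ringZ G]_d) : Prop :=
  forall x, ell2n x -> 0 <= ell2n_dot (mxop D x) x.

Definition kernel_op (D : 'M[group_ringZ G]_d) : set ('I_d -> G -> R[i]) :=
  [set x | ell2n x /\ mxop D x = 0].

(* The projection onto the kernel commutes with the right translations, so it
   lies in Mat_d(NG) and its trace is the von Neumann dimension of the kernel. *)
Definition dim_kernel (D : 'M[group_ringZ G]_d) : R[i] :=
  trGn (orth_proj (kernel_op D)).

End atiyah.

(* Meant for torsion-free countable groups; for other groups integrality is not
   the expected property. *)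
Definition atiyah_conjecture (R : realType) (G : groupType) : Prop :=
  forall (d : nat) (D : 'M[group_ringZ G]_d), (0 < d)%N ->
    self_adjoint R D -> positive_op R D ->
    exists k : int, dim_kernel R D = k%:~R.

(* Main.v *)
Require Import Defs.
From mathcomp Require Import all_boot all_order all_algebra all_fingroup.
From mathcomp Require Import finmap.
From mathcomp Require Import all_classical all_reals all_analysis.
From mathcomp Require Import complex ring lra zify.

(** Idea. Write D as a finite sum of integer matrices times words in the
    generators, so that the same formula F makes sense over every marked group
    and over every tuple of permutations. With S = 1 - F^* F / K for K large,
    S^(2k) applied to a basis vector of l^2(G)^d converges to its projection
    onto ker F, so the traces of S^(2k) converge to dim ker F. For a fixed k
    this trace only depends on the relations of bounded length, so it is the
    same for the limit group and for its close approximants. On the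
    approximants the convergence is uniform: soficity reduces the trace of
    S^(2k) - S^(2l) to integer matrices C, and there the nonzero eigenvalues
    of C^T C have product at least 1, hence only a small proportion of them is
    close to 0. Since F^* F is positive and self-adjoint over every group, the
    Atiyah conjecture applies to it over the approximants (to D itself it might
    not, positivity being lost), so dim ker D is a limit of integers. *)

Import Order.TTheory GRing.Theory Num.Theory.
Import numFieldNormedType.Exports.
Import ComplexField.
Set Implicit Arguments.
Unset Strict Implicit.
Unset Printing Implicit Defensive.
Local Open Scope classical_set_scope.
Local Open Scope ring_scope.

(** * Spectral gap of integer Gram matrices *)

(** The obstacle is an exchange of limits. For each exponent the traces over the approximants
    eventually equal the trace over the limit group, but a dimension is reached only as the exponent
    grows, at a speed governed by the spectrum near 0, which could a priori worsen along the
    sequence. The speed is controlled by the inequality (1 - u)^k <= a (- ln u) for 0 < u <= 1,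
    valid for all k beyond a threshold that depends on [a] only. Summed over the nonzero eigenvalues
    of a matrix of size n, rescaled by K, it turns a lower bound on their product into an error of
    at most a n ln K; neither the threshold nor the factor depends on the matrix. One K has to serve
    all the groups and all the permutation models, since otherwise S would not be a single formula.
    The spectral theorem is applied to finite matrices only; over the groups, norms of iterates and
    traces of powers take its place. *)

Lemma expr_le_ln (R : realType) (a : R) : 0 < a ->
  exists k0, forall k, (k0 <= k)%N -> forall u : R, 0 < u <= 1 ->
    (1 - u) ^+ k <= a * - ln u.
Proof.
(* At [u0] the right-hand side equals 1. Below [u0] it is at least 1; above [u0] the power decays
   geometrically to at most [a], and one spare factor [1 - u] is at most [- ln u]. *)
move=> a0; set u0 := expR (- a^-1).
have u0gt : 0 < u0 by exact: expR_gt0.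
have u0lt : u0 < 1 by rewrite -expR0 ltr_expR oppr_lt0 invr_gt0.
have /cvgrPdist_le /(_ _ a0)[k1 _ Hk1] :
    (fun k => (1 - u0) ^+ k : R) @ \oo --> (0 : R).
  by apply: cvg_expr; rewrite ger0_norm; lra.
exists k1.+1 => k lek u /andP[ugt0 ule1].
case: (leP u u0) => [uu0|u0u].
  apply: (@le_trans _ _ 1); first by rewrite exprn_ile1//; lra.
  have : ln u <= - a^-1 by rewrite -[leRHS]expRK ler_ln.
  rewrite -lerNr => h.
  by rewrite -(@mulfV _ a) ?gt_eqF// ler_pM2l.
rewrite -(prednK (leq_ltn_trans (leq0n _) lek)) exprSr.
have lnu : 1 - u <= - ln u.
  have -> : u = 1 + (u - 1) by lra.
  have := @le_ln1Dx R (u - 1); lra.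
have pk : (1 - u) ^+ k.-1 <= a.
  apply: (@le_trans _ _ ((1 - u0) ^+ k1)); last first.
    by have := Hk1 k1 (leqnn _); rewrite sub0r normrN ger0_norm// exprn_ge0; lra.
  apply: (@le_trans _ _ ((1 - u0) ^+ k.-1)).
    by apply: lerXn2r; rewrite ?nnegrE; lra.
  rewrite ler_wiXn2l//; [lra|lra|].
  by rewrite -ltnS prednK// (leq_ltn_trans _ lek).
apply: (@le_trans _ _ (a * (1 - u))).
  by apply: ler_wpM2r => //; lra.
by rewrite ler_pM2l.
Qed.

(* The nonzero part of the spectrum has product at least 1, so the logarithms
   of the nonzero [f i] have a nonnegative sum, which bounds how many of them
   can be close to 0. *)
Lemma sum_expr_gap (R : realType) (I : finType) (f : I -> R) (K a : R) (k0 : nat) :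
  1 <= K -> 0 < a -> (0 < k0)%N ->
  (forall k, (k0 <= k)%N -> forall u : R, 0 < u <= 1 ->
    (1 - u) ^+ k <= a * - ln u) ->
  (forall i, 0 <= f i <= K) -> 1 <= \prod_(i | f i != 0) f i ->
  forall k l, (k0 <= k)%N -> (k <= l)%N ->
  0 <= \sum_i (1 - f i / K) ^+ k - \sum_i (1 - f i / K) ^+ l
    <= a * ln K * #|I|%:R.
Proof.
move=> K1 a0 k00 hk0 fK prodf k l k0k kl.
have K0 : 0 < K by lra.
have fK1 i : 0 <= f i / K <= 1.
  have /andP[f0 fleK] := fK i.
  by rewrite divr_ge0 ?ler_pdivrMr ?mul1r//; lra.
rewrite -sumrB; apply/andP; split.
  apply: sumr_ge0 => i _; rewrite subr_ge0 ler_wiXn2l//; have := fK1 i; lra.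
(* The indices with [f i = 0] contribute 1 - 1 = 0; for the others the subtracted power is dropped
   and the logarithmic bound is applied to [f i / K]. *)
rewrite (bigID (fun i => f i != 0))/= [X in _ + X]big1 ?addr0; last first.
  by move=> i /negPn/eqP ->; rewrite mul0r subr0 !expr1n subrr.
apply: (@le_trans _ _ (\sum_(i | f i != 0) (a * (ln K - ln (f i))))).
  apply: ler_sum => i fi0.
  have fi : 0 < f i by rewrite lt0r fi0; have /andP[] := fK i.
  have := fK1 i => h.
  apply: (@le_trans _ _ ((1 - f i / K) ^+ k)).
    by rewrite gerDl oppr_le0 exprn_ge0//; lra.
  have -> : ln K - ln (f i) = - ln (f i / K) by rewrite ln_div ?posrE// opprB.
  by rewrite hk0// divr_gt0//=; lra.
rewrite -mulr_sumr -mulrA ler_pM2l// sumrB.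
have -> : \sum_(i | f i != 0) ln (f i) = ln (\prod_(i | f i != 0) f i).
  have : forall i, f i != 0 -> 0 < f i.
    by move=> i fi0; rewrite lt0r fi0; have /andP[] := fK i.
  move=> fpos.
  suff : 0 < \prod_(i | f i != 0) f i /\
     \sum_(i | f i != 0) ln (f i) = ln (\prod_(i | f i != 0) f i) by case.
  apply: (big_ind2 (fun x y => 0 < y /\ x = ln y)).
  - by rewrite ltr01 ln1.
  - by move=> ? x ? y [x0 ->] [y0 ->]; rewrite mulr_gt0// lnM.
  - by move=> i /fpos fi; split.
have lnK : 0 <= ln K by exact: ln_ge0.
have := ln_ge0 prodf => h.
rewrite sumr_const -mulr_natr.
have : ln K * #|(fun i => f i != 0)|%:R <= ln K * #|I|%:R.
  by rewrite ler_wpM2l// ler_nat max_card.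
lra.
Qed.

Lemma expmx_similar (F : comUnitRingType) n (P S : 'M[F]_n) (D : 'rV[F]_n) k :
  P \in unitmx -> S = invmx P *m diag_mx D *m P ->
  S ^+ k = invmx P *m diag_mx (\row_j D 0 j ^+ k) *m P.
Proof.
move=> Pu SE; elim: k => [|k IH].
  rewrite expr0.
  have -> : \row_j D 0 j ^+ 0 = const_mx 1 by apply/rowP => j; rewrite !mxE.
  by rewrite diag_const_mx mulmx1 mulVmx.
rewrite exprS IH SE [LHS]/GRing.mul/= !mulmxA mulmxK// -!mulmxA; congr (_ *m _).
rewrite mulmxA; congr (_ *m _); rewrite mulmx_diag; congr diag_mx.
by apply/rowP => j; rewrite !mxE exprS.
Qed.

Lemma char_poly_similar (F : comUnitRingType) n (P A D : 'M[F]_n) :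
  P \in unitmx -> A = invmx P *m D *m P -> char_poly A = char_poly D.
Proof.
move=> Pu ->; rewrite /char_poly /char_poly_mx !map_mxM.
set Q := map_mx polyC P; set Q' := map_mx polyC (invmx P).
have QQ : Q' *m Q = 1%:M by rewrite -map_mxM mulVmx// map_mx1.
have -> : 'X%:M - Q' *m map_mx polyC D *m Q = Q' *m ('X%:M - map_mx polyC D) *m Q.
  by rewrite mulmxBr mulmxBl -[_ *m 'X%:M *m _]mulmxA -scalar_mxC mulmxA QQ mul1mx.
by rewrite !det_mulmx mulrAC -det_mulmx QQ det1 mul1r.
Qed.

Section gram.
Local Open Scope sesquilinear_scope.
Variables (R : realType) (n : nat) (C : 'M[int]_n) (K : R).
Let A : 'M[int]_n := C^T *m C.
Let AC : 'M[R[i]]_n := map_mx intr A.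
Hypothesis K1 : 1 <= K.
Hypothesis rowK : forall i, \sum_j `|(A i j)%:~R| <= K.

Let P := spectralmx AC.
Let D := spectral_diag AC.

Let Pu : P \in unitmx. Proof. exact: spectral_unit. Qed.

Let conj_int (z : int) : (z%:~R : R[i])^* = z%:~R.
Proof. by rewrite (rmorph_int (@Num.conj R[i])). Qed.

Let ACE : AC = invmx P *m diag_mx D *m P.
Proof.
apply/orthomx_spectralP/symmetric_normalmx.
  apply/is_hermitianmxP; rewrite expr0 scale1r map_mx_id//.
  by rewrite /AC map_trmx /A trmx_mul trmxK.
by apply/mxOverP => i j; rewrite mxE realz.
Qed.

Let rowP_eigen j : row j P *m AC = D 0 j *: row j P.
Proof.
by rewrite -row_mul ACE !mulmxA mulmxV// mul1mx row_mul row_diag_mx -scalemxAl -rowE.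
Qed.

Let rowP_norm j : row j P *m (row j P) ^t*  = 1%:M.
Proof.
have := spectral_unitarymx AC => /unitarymxP H.
apply/matrixP => a b; rewrite !ord1 !mxE eqxx/=.
have := congr1 (fun M : 'M[R[i]]_(n, n) => M j j) H; rewrite !mxE eqxx/= => <-.
by apply: eq_bigr => k _; rewrite !mxE.
Qed.

(** At a unit eigenvector [v] the eigenvalue is the squared norm of [v] times the transpose of
    [C]. *)
Let D_ge0 j : 0 <= D 0 j.
Proof.
set v := row j P.
have -> : D 0 j = (v *m AC *m v ^t* ) 0 0.
  by rewrite rowP_eigen -scalemxAl rowP_norm !mxE mulr1.
set u := v *m (map_mx intr C)^T.
have -> : v *m AC *m v ^t*  = u *m u  ^t*  .
  rewrite /u /AC /A map_mxM !trmx_mul !map_mxM -!mulmxA; congr (_ *m _).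
  rewrite map_trmx; congr (_ *m _); congr (_ *m _).
  apply/matrixP => a b; rewrite !mxE. by rewrite [RHS]conj_int.
by rewrite mxE sumr_ge0// => k _; rewrite !mxE mul_conjC_ge0.
Qed.

(** Gershgorin's argument: compare both sides of the eigenvector equation at a coordinate of largest
    modulus. Since [A] is symmetric, the row sums also bound the column sums that occur there. *)
Let D_leK j : D 0 j <= K%:C%C.
Proof.
set v := row j P.
have [i0 vi0] : exists i, v 0 i != 0.
  apply/existsP; apply: contraT => /existsPn H.
  have v0 : v = 0.
    apply/rowP => i; apply/eqP; have := H i. by rewrite negbK => /eqP ->; rewrite mxE.
  have := rowP_norm j; rewrite -/v v0 mul0mx => /matrixP/(_ 0 0).
  by rewrite !mxE eqxx => /esym/eqP; rewrite oner_eq0.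
pose N i := Normc.normc (v 0 i).
have NE i : `|v 0 i| = (N i)%:C%C by [].
have [i Hi] : exists i, forall k, N k <= N i.
  by exists [arg max_(i > i0) N i]%O; case: arg_maxP => // i _ H k; exact: H.
have vi : 0 < (N i)%:C%C.
  apply: lt_le_trans (_ : `|v 0 i0| <= _); first by rewrite normr_gt0.
  by rewrite NE lecR.
rewrite -(ler_pM2r vi) -[leLHS]ger0_norm ?mulr_ge0// ?(ltW vi)// normrM.
rewrite -NE normr_id -normrM.
have -> : D 0 j * v 0 i = (D 0 j *: v) 0 i by rewrite [RHS]mxE.
rewrite -rowP_eigen -/v.
rewrite mxE (le_trans (ler_norm_sum _ _ _))//.
apply: (@le_trans _ _ (\sum_k (N i * `|(A i k)%:~R|)%:C%C)).
  apply: ler_sum => k _; rewrite normrM NE.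
  have -> : (N i * `|(A i k)%:~R|)%:C%C = (N i)%:C%C * `|(A i k)%:~R : R|%:C%C.
    exact: (rmorphM (real_complex R)).
  apply: ler_pM => //; first by rewrite -NE.
    by rewrite lecR.
  rewrite mxE; have -> : A k i = A i k.
    by rewrite !mxE; apply: eq_bigr => l _; rewrite !mxE mulrC.
  rewrite -(rmorph_int (real_complex R)) lecR.
  by rewrite /= expr0n addr0 sqrtr_sqr.
rewrite -rmorph_sum -mulr_sumr/= NE -[leRHS](rmorphM (real_complex R)) lecR mulrC.
by rewrite ler_wpM2r// -lecR; exact: ltW.
Qed.

Let f j := complex.Re (D 0 j).
Let DE j : D 0 j = (f j)%:C%C.
Proof. by rewrite RRe_real// ger0_real. Qed.

Let S : 'M[R]_n := 1%:M - K^-1 *: map_mx intr A.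

Let mxtrace_S k : \tr (S ^+ k) = \sum_j (1 - f j / K) ^+ k.
Proof.
apply: (@complexI R).
have -> : (\tr (S ^+ k))%:C%C = \tr (map_mx (real_complex R) S ^+ k).
  by rewrite -rmorphXn -trace_map_mx.
have SE : map_mx (real_complex R) S =
    invmx P *m diag_mx (\row_j (1 - D 0 j / K%:C%C)) *m P.
  have -> : map_mx (real_complex R) S = 1%:M - K%:C%C^-1 *: AC.
    rewrite /S map_mxD map_mxN map_mxZ map_mx1 fmorphV; congr (_ - _ *: _).
    by apply/matrixP => a b; rewrite !mxE rmorph_int.
  have -> : \row_j (1 - D 0 j / K%:C%C) = const_mx 1 - K%:C%C^-1 *: D.
    by apply/rowP => j; rewrite !mxE mulrC.
  rewrite linearB/= diag_const_mx mulmxBr mulmxBl mulmx1 mulVmx//.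
  have -> : diag_mx (K%:C%C^-1 *: D) = K%:C%C^-1 *: diag_mx D by exact: linearZ.
  by rewrite -scalemxAr -scalemxAl -ACE.
rewrite (expmx_similar _ Pu SE) mxtrace_mulC mulmxA mulmxV// mul1mx mxtrace_diag.
rewrite [RHS]rmorph_sum; apply: eq_bigr => j _.
by rewrite !mxE DE [RHS]rmorphXn rmorphB rmorph1 rmorphM fmorphV.
Qed.

(** If 0 is an eigenvalue of multiplicity [m], the coefficient of degree [m] of the characteristic
    polynomial is, up to sign, the product of the nonzero eigenvalues. It is a nonzero integer
    because [A] is an integer matrix. *)
Let prod_eigen : 1 <= \prod_(j | f j != 0) f j.
Proof.
have cpE : map_poly intr (char_poly A) = \prod_(j < n) ('X - (D 0 j)%:P) :> {poly R[i]}.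
  rewrite map_char_poly -/AC (char_poly_similar Pu ACE) char_poly_trig ?diag_mx_is_trig//.
  by apply: eq_bigr => j _; rewrite mxE eqxx.
pose m := #|[pred j | ~~ (f j != 0)]|.
have cpm : ((char_poly A)`_m)%:~R = \prod_(j | f j != 0) (- D 0 j) :> R[i].
  rewrite -coef_map/= cpE (bigID (fun j => f j != 0))/=.
  rewrite [X in _ * X](eq_bigr (fun=> 'X)); last first.
    by move=> j /negPn/eqP fj; rewrite DE fj subr0.
  rewrite prodr_const coefMXn ltnn subnn -horner_coef0 horner_prod.
  by apply: eq_bigr => j _; rewrite !hornerE.
have fpos : 0 < \prod_(j | f j != 0) f j.
  by apply: prodr_gt0 => j fj; rewrite lt0r fj/= -ler0c -DE D_ge0.
have : `|(char_poly A)`_m|%:~R = (\prod_(j | f j != 0) f j)%:C%C :> R[i].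
  rewrite intr_norm cpm normr_prod rmorph_prod; apply: eq_bigr => j _.
  by rewrite normrN ger0_norm// DE.
rewrite -(rmorph_int (real_complex R)) => /complexI h.
move: fpos; rewrite -h ltr0z => fpos.
by rewrite -[1]/(1%:~R) ler_int.
Qed.

(** The bound is linear in the size [n], so it survives the normalisation of traces in models of
    growing size. *)
Lemma mxtrace_gram_gap (a : R) (k0 : nat) : 0 < a -> (0 < k0)%N ->
  (forall k, (k0 <= k)%N -> forall u : R, 0 < u <= 1 ->
    (1 - u) ^+ k <= a * - ln u) ->
  forall k l, (k0 <= k)%N -> (k <= l)%N ->
  0 <= \tr (S ^+ k) - \tr (S ^+ l) <= a * ln K * n%:R.
Proof.
move=> a0 k00 hk0 k l k0k kl; rewrite !mxtrace_S -[n in n%:R]card_ord.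
apply: (sum_expr_gap K1 a0 k00 hk0) => // j.
by rewrite -ler0c -lecR -DE D_ge0 D_leK.
Qed.

End gram.

(** * Formal operators *)

Section words.
Variables (m : nat) (G : groupType) (s : 'I_m -> G).

Lemma word_eval_nil : word_eval s [::] = 1%g.
Proof. by rewrite /word_eval big_nil. Qed.

Lemma word_eval_cons l w :
  (word_eval s (l :: w) = (if l.2 then (s l.1)^-1 else s l.1) * word_eval s w)%g.
Proof. by rewrite /word_eval big_cons. Qed.

Lemma word_eval_cat w1 w2 :
  (word_eval s (w1 ++ w2) = word_eval s w1 * word_eval s w2)%g.
Proof. by rewrite /word_eval big_cat. Qed.

Definition inv_word (w : word m) : word m := rev [seq (l.1, ~~ l.2) | l <- w].

Lemma word_eval_inv w : (word_eval s (inv_word w) = (word_eval s w)^-1)%g.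
Proof.
elim: w => [|[i b] w IH]; first by rewrite /inv_word /= word_eval_nil invg1.
rewrite /inv_word /= rev_cons -cats1 word_eval_cat -/(inv_word w) IH.
rewrite !word_eval_cons word_eval_nil.
by rewrite invgM mulg1; case: b => /=; rewrite ?invgK.
Qed.

End words.

(* A formal operator is a finite sum of terms [M (x) w] with [M] a matrix and
   [w] a word, to be evaluated in any marked group or permutation group. *)
Definition fop (m d : nat) (A : Type) := seq ('M[A]_d * word m).

Section formal_operators.
Variables (m d : nat).

Definition fop_one (A : pzRingType) : fop m d A := [:: (1%:M, [::])].

Definition fop_mul (A : pzRingType) (F E : fop m d A) : fop m d A :=
  [seq (p.1 *m q.1, p.2 ++ q.2) | p <- F, q <- E].

(** The transpose is not conjugated: the adjoint is taken of operators with integer coefficients. *)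
Definition fop_adj (A : pzRingType) (F : fop m d A) : fop m d A :=
  [seq (p.1^T, inv_word p.2) | p <- F].

Definition fop_exp (A : pzRingType) (F : fop m d A) (k : nat) : fop m d A :=
  iter k (fop_mul F) (fop_one A).

Definition fop_contraction (R : realType) (K : R) (F : fop m d int) : fop m d R :=
  (1%:M, [::]) ::
  [seq (- K^-1 *: map_mx intr p.1, p.2) | p <- fop_mul (fop_adj F) F].

(** The canonical trace on matrices over the group ring. It only sees which of the finitely many
    words of [F] are relations. *)
Definition fop_trace (A : pzRingType) (G : groupType) (s : 'I_m -> G)
  (F : fop m d A) : A := \sum_(p <- F) \tr p.1 *+ (word_eval s p.2 == 1%g).

Section permutation_model.
Variables (N : nat) (s : 'I_m -> 'S_N).
Local Notation n := #|{: 'I_d * 'I_N}|.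

(** Rows and columns are indexed by pairs of a matrix index and a point. A word sends the point of
    the row to the point of the column, which is multiplicative for the left-to-right product of
    permutations. *)
Definition fop_mx (A : pzRingType) (F : fop m d A) : 'M[A]_n :=
  \matrix_(a, b) \sum_(p <- F) p.1 (enum_val a).1 (enum_val b).1
    *+ ((word_eval s p.2 : 'S_N) (enum_val a).2 == (enum_val b).2).

Lemma fop_mx_mul (A : pzRingType) (F E : fop m d A) :
  fop_mx (fop_mul F E) = fop_mx F *m fop_mx E.
Proof.
apply/matrixP => a c; rewrite !mxE /fop_mul big_allpairs_dep.
under [RHS]eq_bigr do rewrite !mxE mulr_suml.
rewrite [RHS]exchange_big/=; apply: eq_bigr => p _.
under [RHS]eq_bigr do rewrite mulr_sumr.
rewrite [RHS]exchange_big/=; apply: eq_bigr => q _ /=.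
rewrite (reindex (@enum_rank _)) /=; last by apply: onW_bij; exact: enum_rank_bij.
under [RHS]eq_bigr do rewrite enum_rankK.
rewrite -(pair_bigA _ (fun j w =>
   (p.1 (enum_val a).1 j *+ ((word_eval s p.2 : 'S_N) (enum_val a).2 == w)) *
   (q.1 j (enum_val c).1 *+ ((word_eval s q.2 : 'S_N) w == (enum_val c).2)))) /=.
rewrite mxE -sumrMnl; apply: eq_bigr => j _.
rewrite (bigD1 ((word_eval s p.2 : 'S_N) (enum_val a).2))//= eqxx mulr1n big1 ?addr0; last first.
  by move=> w /negPf; rewrite eq_sym => ->; rewrite mulr0n mul0r.
by rewrite mulrnAr word_eval_cat permM.
Qed.

Lemma fop_mx_one (A : pzRingType) : fop_mx (fop_one A) = 1%:M.
Proof.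
apply/matrixP => a b; rewrite !mxE big_seq1/= word_eval_nil perm1 mxE.
rewrite -(inj_eq enum_val_inj); case: (enum_val a) (enum_val b) => i w [j v] /=.
by rewrite xpair_eqE; case: eqP; case: eqP; rewrite ?mulr0n ?mulr1n ?mul0rn.
Qed.

Lemma fop_mx_exp (A : pzRingType) (F : fop m d A) k :
  fop_mx (fop_exp F k) = fop_mx F ^+ k.
Proof.
elim: k => [|k IH]; first by rewrite expr0 fop_mx_one.
by rewrite /fop_exp iterS fop_mx_mul -/(fop_exp F k) IH exprS.
Qed.

Lemma fop_mx_adj (A : pzRingType) (F : fop m d A) : fop_mx (fop_adj F) = (fop_mx F)^T.
Proof.
apply/matrixP => a b; rewrite !mxE big_map; apply: eq_bigr => p _ /=.
rewrite mxE word_eval_inv; congr (_ *+ _); congr nat_of_bool.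
by rewrite -(inj_eq (@perm_inj _ (word_eval s p.2 : 'S_N))) permKV eq_sym.
Qed.

Lemma fop_mx_contraction (R : realType) (K : R) (F : fop m d int) :
  fop_mx (fop_contraction K F) =
  1%:M - K^-1 *: map_mx intr ((fop_mx F)^T *m fop_mx F).
Proof.
rewrite -fop_mx_adj -fop_mx_mul -(fop_mx_one R).
apply/matrixP => a b; rewrite !mxE big_cons/= big_seq1 /=; congr (_ + _).
rewrite big_map rmorph_sum mulr_sumr -sumrN; apply: eq_bigr => p _ /=.
by rewrite !mxE rmorphMn/= mulrnAr mulNr mulNrn.
Qed.

(** To be compared with [fop_trace]: the proportion of fixed points plays the part of the indicator
    that the word is trivial. *)
Lemma mxtrace_fop_mx (A : pzRingType) (F : fop m d A) :
  \tr (fop_mx F) = \sum_(p <- F) \tr p.1 *+ num_fix (word_eval s p.2 : 'S_N).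
Proof.
rewrite /mxtrace; under eq_bigr do rewrite mxE.
rewrite exchange_big/=; apply: eq_bigr => p _.
rewrite (reindex (@enum_rank _)) /=; last by apply: onW_bij; exact: enum_rank_bij.
under eq_bigr do rewrite enum_rankK.
rewrite -(pair_bigA _ (fun j w => p.1 j j *+ ((word_eval s p.2 : 'S_N) w == w))) /=.
rewrite -sumrMnl; apply: eq_bigr => j _.
rewrite sumrMnr /num_fix cardsE -sum1_card [in RHS]big_mkcond/=; congr (_ *+ _).
Qed.

(** A bound on the row sums, hence on the eigenvalues of symmetric models, that ignores the
    permutations and their degree. *)
Definition fop_abs (F : fop m d int) : int :=
  \sum_(p <- F) \sum_i \sum_j `|p.1 i j|.

Lemma fop_mx_row_sum (F : fop m d int) a : \sum_b `|fop_mx F a b| <= fop_abs F.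
Proof.
apply: (@le_trans _ _ (\sum_b \sum_(p <- F) `|p.1 (enum_val a).1 (enum_val b).1|
    *+ ((word_eval s p.2 : 'S_N) (enum_val a).2 == (enum_val b).2))).
  apply: ler_sum => b _; rewrite mxE; apply: le_trans (ler_norm_sum _ _ _) _.
  by apply: ler_sum => p _; rewrite normrMn.
rewrite exchange_big/=; apply: ler_sum => p _.
rewrite (reindex (@enum_rank _)) /=; last by apply: onW_bij; exact: enum_rank_bij.
under eq_bigr do rewrite enum_rankK.
rewrite -(pair_bigA _ (fun j w =>
  `|p.1 (enum_val a).1 j| *+ ((word_eval s p.2 : 'S_N) (enum_val a).2 == w))) /=.
rewrite [leRHS](bigD1 (enum_val a).1)//=.
apply: (@le_trans _ _ (\sum_j `|p.1 (enum_val a).1 j|)); last first.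
  by rewrite lerDl sumr_ge0// => i _; rewrite sumr_ge0.
apply: ler_sum => j _.
rewrite (bigD1 ((word_eval s p.2 : 'S_N) (enum_val a).2))//= eqxx mulr1n big1 ?addr0//.
by move=> w /negPf; rewrite eq_sym => ->; rewrite mulr0n.
Qed.

End permutation_model.
End formal_operators.

(** * Sofic approximation *)

Section hamming.
Variable N : nat.
Implicit Types p q r : 'S_N.

Definition hamming p q : nat := #|[set i | p i != q i]%SET|.

Lemma hamming_triangle q p r : (hamming p r <= hamming p q + hamming q r)%N.
Proof.
apply: leq_trans (leq_card_setU _ _).
apply/subset_leq_card/fintype.subsetP => i; rewrite !inE.
by apply: contraNT; rewrite negb_or !negbK => /andP[/eqP -> /eqP ->].
Qed.

Lemma hamming_mulr r p q : hamming (r * p)%g (r * q)%g = hamming p q.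
Proof.
rewrite /hamming -(card_imset _ (@perm_inj _ r)); apply: eq_card => i.
rewrite inE; apply/imsetP/idP => [[j]|h].
  by rewrite inE !permM => h ->.
by exists (r^-1%g i); rewrite ?inE ?permM permKV.
Qed.

Lemma hamming_mull r p q : hamming (p * r)%g (q * r)%g = hamming p q.
Proof.
by apply: eq_card => i; rewrite !inE !permM (inj_eq (@perm_inj _ r)).
Qed.

(** Turns the almost multiplicativity required by soficity, which counts fixed points, into
    closeness for a bi-invariant distance. *)
Lemma hamming_num_fix p q : (num_fix (p * q^-1)%g + hamming p q)%N = N.
Proof.
have := cardsC [set i | (p * q^-1)%g i == i]%SET; rewrite card_ord.
apply: etrans; congr (_ + _)%N; apply: eq_card => i.
by rewrite !inE permM -[in RHS](inj_eq (@perm_inj _ q)) permKV.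
Qed.

Lemma num_fix_le p q : (num_fix p <= num_fix q + hamming p q)%N.
Proof.
have := hamming_num_fix p 1%g; have := hamming_num_fix q 1%g.
rewrite invg1 !mulg1.
have := hamming_triangle p q 1%g; have -> : hamming q p = hamming p q.
  by apply: eq_card => i; rewrite !inE eq_sym.
move: (num_fix p) (num_fix q) (hamming p 1%g) (hamming q 1%g) (hamming p q) => *; lia.
Qed.

End hamming.

Lemma words_finite m L : exists W : seq (word m), forall w, (size w <= L)%N -> w \in W.
Proof.
elim: L => [|L [W HW]]; first by exists [:: [::]] => -[].
exists ([::] :: [seq l :: w | l <- enum {: 'I_m * bool}, w <- W]) => -[|l w]//= h.
by rewrite inE; apply/orP; right; apply/allpairsP; exists (l, w); rewrite /= mem_enum HW.
Qed.

(** The permutations are the values of [phi] at the generators. Each letter of a word moves its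
    evaluation away from [phi] of its value by at most twice [eps]: once for multiplicativity, once
    for comparing [phi] of an inverse with the inverse of [phi]. *)
Lemma sofic_words (R : realType) (G : groupType) (m : nat) (s : 'I_m -> G) :
  sofic R G -> forall (L : nat) (delta : R), 0 < delta ->
  exists N : nat, (0 < N)%N /\ exists sigma : 'I_m -> 'S_N,
    forall w : word m, (size w <= L)%N ->
    `|(num_fix (word_eval sigma w : 'S_N))%:R - (word_eval s w == 1%g)%:R * N%:R|
      <= delta * N%:R.
Proof.
(* Length at least 1 puts the generators and their inverses into [F], even when [L0] is 0. *)
move=> sofG L0 delta delta0; set L := maxn L0 1.
(* Two errors per letter, and one more for the fixed points of [phi] at a nontrivial element. *)
set c : R := (2 * L + 1)%:R.
have c0 : 0 < c by rewrite ltr0n addn1.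
(* Smaller than 1 however large [delta] is, and still [c * eps <= delta]. *)
set eps := delta / (c + delta).
have eps01 : 0 < eps < 1 by rewrite divr_gt0 ?ltr_pdivrMr ?mul1r/=; lra.
have ceps : c * eps <= delta.
  by rewrite mulrC /eps mulrAC ler_pdivrMr ?ler_pM2l//; lra.
have [W HW] := words_finite m L.
pose F : {fset G} := [fset g | g in [seq word_eval s w | w <- W]]%fset.
have FW w : (size w <= L)%N -> word_eval s w \in F.
  by move=> /HW wW; rewrite !inE/=; apply/mapP; exists w.
have [N [N0 [phi [phiM phi1 phifix]]]] := sofG eps F eps01.
have hamM e f : e \in F -> f \in F ->
    (hamming (phi e * phi f)%g (phi (e * f)%g))%:R <= eps * N%:R.
  move=> eF fF; have := phiM _ _ eF fF.
  have := congr1 (fun n => n%:R : R) (hamming_num_fix (phi e * phi f)%g (phi (e * f)%g)).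
  by rewrite natrD; lra.
exists N; split => //; exists (fun i => phi (s i)).
have one_letter l : word_eval s [:: l] = (if l.2 then (s l.1)^-1 else s l.1)%g.
  by rewrite word_eval_cons word_eval_nil mulg1.
have letter_F l : (if l.2 then (s l.1)^-1 else s l.1)%g \in F.
  by rewrite -one_letter FW// leq_maxr.
have Hw w : (size w <= L)%N ->
    (hamming (word_eval (fun i => phi (s i)) w : 'S_N) (phi (word_eval s w)))%:R
    <= (2 * size w)%:R * eps * N%:R.
  elim: w => [_|l w IH /= wL].
    rewrite !word_eval_nil phi1 /hamming.
    have -> : #|[set i | (1 : 'S_N)%g i != (1 : 'S_N)%g i]%SET| = 0%N.
      by apply: eq_card0 => i; rewrite !inE eqxx.
    by rewrite muln0 !mul0r.
  have {}IH := IH (ltnW wL).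
  pose sw : 'S_N := word_eval (fun i => phi (s i)) w.
  set a : G := (if l.2 then (s l.1)^-1 else s l.1)%g.
  set sa : 'S_N := (if l.2 then (phi (s l.1))^-1 else phi (s l.1))%g.
  have ha : (hamming sa (phi a))%:R <= eps * N%:R.
    rewrite /sa /a; case: l wL {sa a} => i [] wL /=; last first.
      have -> : hamming (phi (s i)) (phi (s i)) = 0%N.
        by apply: eq_card0 => j; rewrite !inE eqxx.
      by rewrite mulr_ge0//; lra.
    (* [phi (s i)] times [phi] of the inverse is close to [phi 1], which is 1; multiplying on the
       left by the inverse of [phi (s i)] keeps the distance. *)
    have := hamM _ _ (letter_F (i, false)) (letter_F (i, true)).
    by rewrite /= mulgV phi1 -[hamming (phi (s i))^-1 _](hamming_mulr (phi (s i))) mulgV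
       /hamming; congr (_%:R <= _); apply: eq_card => j; rewrite !inE eq_sym.
  rewrite !word_eval_cons -/a -/sa -/sw.
  have h1 := hamM _ _ (letter_F l) (FW _ (ltnW wL)).
  have t1 := hamming_triangle (phi a * phi (word_eval s w))%g (sa * sw)%g
    (phi (a * word_eval s w)%g).
  have t2 := hamming_triangle (phi a * sw)%g (sa * sw)%g
    (phi a * phi (word_eval s w))%g.
  rewrite hamming_mull hamming_mulr in t2.
  have := leq_trans t1 (leq_add t2 (leqnn _)); rewrite -(ler_nat R) !natrD => h2.
  apply: (le_trans h2).
  have -> : (2 * (size w).+1)%:R * eps * N%:R =
      eps * N%:R + (2 * size w)%:R * eps * N%:R + eps * N%:R.
    by rewrite mulnS natrD; ring.
  by rewrite lerD// lerD.
move=> w wL0; have wL : (size w <= L)%N by rewrite (leq_trans wL0)// leq_maxl.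
have {}Hw := Hw w wL; pose sw : 'S_N := word_eval (fun i => phi (s i)) w.
rewrite -/sw in Hw *.
have lN : (2 * size w)%:R * eps * N%:R + eps * N%:R <= delta * N%:R.
  rewrite -mulrDl ler_wpM2r//; apply: le_trans ceps.
  rewrite -[X in _ + X]mul1r -mulrDl ler_wpM2r//; first lra.
  by rewrite /c natrD lerD2r ler_nat leq_mul2l.
have eN : 0 <= eps * N%:R by rewrite mulr_ge0//; lra.
case: eqP => [w1|/eqP w1].
  rewrite mul1r; rewrite w1 phi1 in Hw.
  have := congr1 (fun n => n%:R : R) (hamming_num_fix sw 1%g).
  rewrite invg1 mulg1 natrD => h.
  by rewrite ler_norml; apply/andP; split; have := ler0n R (hamming sw 1%g); lra.
rewrite mul0r subr0 ger0_norm//.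
have := phifix _ (FW _ wL) w1.
have := num_fix_le sw (phi (word_eval s w)); rewrite -(ler_nat R) natrD.
lra.
Qed.

(** Two operators are treated at once because two powers of the same contraction have to be compared
    inside one permutation model. *)
Lemma fop_trace_approx (R : realType) (m d : nat) (G : groupType) (s : 'I_m -> G)
    (F : fop m d R) (eta : R) : sofic R G -> 0 < eta ->
  forall E : fop m d R, 
  exists N : nat, (0 < N)%N /\ exists sigma : 'I_m -> 'S_N,
    `|\tr (fop_mx sigma F) - fop_trace s F * N%:R| <= eta * N%:R /\
    `|\tr (fop_mx sigma E) - fop_trace s E * N%:R| <= eta * N%:R.
Proof.
move=> sofG eta0 E.
pose L := (\max_(p <- F ++ E) size p.2)%N.
(* Total weight of the words, so that an error [eta / c] per word is enough; the summand 1 keeps it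
   positive. *)
pose c : R := 1 + \sum_(p <- F ++ E) `|\tr p.1|.
have c0 : 0 < c by rewrite ltr_pwDl// sumr_ge0.
have [N [N0 [sigma H]]] := sofic_words s sofG L (divr_gt0 eta0 c0).
exists N; split => //; exists sigma.
suff K (E' : fop m d R) : {subset E' <= F ++ E} ->
   \sum_(p <- E') `|\tr p.1| <= c ->
   `|\tr (fop_mx sigma E') - fop_trace s E' * N%:R| <= eta * N%:R.
  split; apply: K => //.
  - by move=> p pF; rewrite mem_cat pF.
  - by rewrite /c big_cat/=; have : 0 <= \sum_(p <- E) `|\tr p.1|; [exact: sumr_ge0|lra].
  - by move=> p pF; rewrite mem_cat pF orbT.
  - by rewrite /c big_cat/=; have : 0 <= \sum_(p <- F) `|\tr p.1|; [exact: sumr_ge0|lra].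
move=> sub le.
rewrite mxtrace_fop_mx /fop_trace mulr_suml -sumrB.
apply: le_trans (ler_norm_sum _ _ _) _.
apply: (@le_trans _ _ (\sum_(p <- E') `|\tr p.1| * (eta / c * N%:R))).
  rewrite big_seq [leRHS]big_seq; apply: ler_sum => p pE.
  have -> : \tr p.1 *+ num_fix (word_eval sigma p.2 : 'S_N) -
      \tr p.1 *+ (word_eval s p.2 == 1%g) * N%:R = \tr p.1 *
      ((num_fix (word_eval sigma p.2 : 'S_N))%:R - (word_eval s p.2 == 1%g)%:R * N%:R).
    by rewrite mulrBr mulrA !mulr_natr.
  rewrite normrM.
  rewrite ler_wpM2l// H//.
  by rewrite /L (big_rem p) ?leq_maxl// sub.
rewrite -mulr_suml mulrA; apply: ler_wpM2r => //.
rewrite mulrCA; apply: ler_piMr; first exact: ltW.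
by rewrite ler_pdivrMr ?mul1r.
Qed.

(** After division by [N], both traces are approximated in one permutation model as accurately as
    desired. The gap of integer Gram matrices holds there with constants independent of [N], hence
    it passes to the group. *)
Lemma fop_trace_gap (R : realType) (m d : nat) (G : groupType) (s : 'I_m -> G)
    (F : fop m d int) (K a : R) (k0 : nat) : sofic R G ->
  1 <= K -> (fop_abs (fop_mul (fop_adj F) F))%:~R <= K -> 0 < a -> (0 < k0)%N ->
  (forall k, (k0 <= k)%N -> forall u : R, 0 < u <= 1 ->
    (1 - u) ^+ k <= a * - ln u) ->
  forall k l, (k0 <= k)%N -> (k <= l)%N ->
  `|fop_trace s (fop_exp (fop_contraction K F) k) -
    fop_trace s (fop_exp (fop_contraction K F) l)| <= a * ln K * d%:R.
Proof.
move=> sofG K1 FK a0 k00 hk0 k l k0k kl.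
set Tk := fop_trace s _; set Tl := fop_trace s _.
apply/ler_addgt0Pr => e e0.
have [N [N0 [sigma [ak al]]]] := fop_trace_approx s
  (fop_exp (fop_contraction K F) k) sofG (divr_gt0 e0 (ltr0n R 2))
  (fop_exp (fop_contraction K F) l).
rewrite -/Tk -/Tl !fop_mx_exp !fop_mx_contraction in ak al.
have row_le i : \sum_j `|(((fop_mx sigma F)^T *m fop_mx sigma F) i j)%:~R| <= K.
  apply: le_trans FK; rewrite -fop_mx_adj -fop_mx_mul.
  under eq_bigr do rewrite -intr_norm.
  by rewrite -rmorph_sum/= ler_int fop_mx_row_sum.
have := mxtrace_gram_gap K1 row_le a0 k00 hk0 k0k kl.
move=> /andP[g0]; have -> : #|{: 'I_d * 'I_N}|%:R = d%:R * N%:R :> R.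
  by rewrite card_prod !card_ord natrM.
move=> gle.
have NR : 0 < N%:R :> R by rewrite ltr0n.
rewrite -(ler_pM2r NR) -[X in _ * X]ger0_norm ?ler0n// -normrM mulrBl.
rewrite mulrDl.
move: ak al; rewrite !ler_norml => /andP[? ?] /andP[? ?].
rewrite mulrA in gle; apply/andP; split; lra.
Qed.

(** * Square-summable functions *)

Lemma max_sub_maxN (R : realDomainType) (x : R) :
  Num.max x 0 - Num.max (- x) 0 = x.
Proof. by case: (ltP x 0); case: (ltP (- x) 0); lra. Qed.

Section real_families.
Variables (R : realType) (T : choiceType).
Implicit Types (f g u v : T -> R) (M c : R).

Definition nneg_sum u : \bar R := (\esum_(t in [set: T]) (u t)%:E)%E.

Definition abs_summable f := (nneg_sum (fun t => `|f t|%R) < +oo)%E.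

Lemma nneg_sum_leP u M : (forall t, 0 <= u t) ->
  (nneg_sum u <= M%:E)%E <->
  (forall s : seq T, uniq s -> \sum_(t <- s) u t <= M).
Proof.
move=> u0; split=> [uM s us|H].
  rewrite -lee_fin; apply: le_trans uM; apply: esum_ge.
  exists [set` s]; first by split => //; exact: finite_seq.
  by rewrite -fsbig_seq//= sumEFin.
apply: ge_ereal_sup => _ [A [finA _] <-].
by rewrite fsbig_finite// sumEFin lee_fin H ?fset_uniq.
Qed.

Lemma nneg_sum_fin u : (forall t, 0 <= u t) -> (nneg_sum u < +oo)%E ->
  nneg_sum u \is a fin_num.
Proof. by move=> u0 uoo; rewrite ge0_fin_numE// esum_ge0 => // t _; rewrite lee_fin. Qed.

Lemma nneg_sum_ge u t : (forall t, 0 <= u t) -> ((u t)%:E <= nneg_sum u)%E.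
Proof.
move=> u0; apply: esum_ge; exists [set t]; last by rewrite fsbig_set1.
by split => //; exact: finite_set1.
Qed.

Lemma le_nneg_sum u v : (forall t, u t <= v t) -> (nneg_sum u <= nneg_sum v)%E.
Proof. by move=> uv; apply: le_esum => t _; rewrite lee_fin. Qed.

Lemma nneg_sumD u v : (forall t, 0 <= u t) -> (forall t, 0 <= v t) ->
  (nneg_sum (fun t => u t + v t)%R = nneg_sum u + nneg_sum v)%E.
Proof.
move=> u0 v0; rewrite -esumD; last 2 first.
  by move=> t _; rewrite lee_fin.
  by move=> t _; rewrite lee_fin.
by apply: eq_esum => t _; rewrite EFinD.
Qed.

Lemma nneg_sumZ c u : 0 <= c -> (forall t, 0 <= u t) ->
  (nneg_sum u < +oo)%E -> (nneg_sum (fun t => c * u t)%R = c%:E * nneg_sum u)%E.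
Proof.
move=> c0 u0 uoo.
(* One inequality suffices: applied to [c] and then to its inverse, it gives the equality. *)
have le d w : 0 <= d -> (forall t, 0 <= w t) -> (nneg_sum w < +oo)%E ->
    (nneg_sum (fun t => d * w t)%R <= d%:E * nneg_sum w)%E.
  move=> d0 w0 woo; have wfin := nneg_sum_fin w0 woo.
  rewrite -(fineK wfin) -EFinM.
  have dw0 t : 0 <= d * w t by rewrite mulr_ge0.
  apply/(nneg_sum_leP _ dw0) => s us; rewrite -mulr_sumr ler_wpM2l//.
  by apply: (proj1 (nneg_sum_leP _ w0)) => //; rewrite fineK.
apply/eqP; rewrite eq_le le//=.
have [->|cn0] := eqVneq c 0.
  by rewrite mul0e esum_ge0// => t _; rewrite mul0r.
have {cn0}c0 : 0 < c by rewrite lt0r cn0.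
have ufin := nneg_sum_fin u0 uoo.
have cu0 t : 0 <= c * u t by rewrite mulr_ge0// ltW.
have cuoo : (nneg_sum (fun t => c * u t)%R < +oo)%E.
  by apply: (le_lt_trans (le _ _ (ltW c0) u0 uoo)); rewrite -(fineK ufin) -EFinM ltry.
have := le c^-1 (fun t => c * u t)%R; rewrite invr_ge0 (ltW c0) => /(_ isT cu0 cuoo).
have -> : (fun t => c^-1 * (c * u t)) = u.
  by apply/funext => t; rewrite mulrA mulVf ?mul1r// gt_eqF.
by rewrite -lee_pdivlMl.
Qed.

Lemma abs_summable_le f u : (forall t, `|f t| <= u t) ->
  (nneg_sum u < +oo)%E -> abs_summable f.
Proof. by move=> fu; apply: le_lt_trans; exact: le_nneg_sum. Qed.

Lemma abs_summableZ c f : abs_summable f -> abs_summable (fun t => c * f t).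
Proof.
move=> sf; apply: (@abs_summable_le _ (fun t => `|c| * `|f t|)).
  by move=> t; rewrite normrM.
by rewrite nneg_sumZ// -(fineK (nneg_sum_fin _ sf))// -EFinM ltry.
Qed.

Lemma real_sum_pos u : (forall t, 0 <= u t) -> real_sum u = fine (nneg_sum u).
Proof.
move=> u0; rewrite /real_sum; congr fine.
have -> : (\esum_(t in [set: T]) (EFin \o u)^\- t = 0)%E.
  apply: esum1 => t _; rewrite funenegE/=.
  by apply/eqP; rewrite -EFin_max eqe; apply/eqP/max_idPr; rewrite oppr_le0.
rewrite sube0; apply: eq_esum => t _; rewrite funeposE/=.
by apply/eqP; rewrite -EFin_max eqe; apply/eqP/max_idPl.
Qed.

(** Positive and negative parts are not additive, but any splitting into summable nonnegative
    families gives the same difference: if p - q = u - v then p + v = u + q. Linearity of [real_sum]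
    rests on this freedom. *)
Lemma real_sum_sub u v : (forall t, 0 <= u t) -> (forall t, 0 <= v t) ->
  (nneg_sum u < +oo)%E -> (nneg_sum v < +oo)%E ->
  real_sum (fun t => u t - v t) = fine (nneg_sum u) - fine (nneg_sum v).
Proof.
move=> u0 v0 uoo voo; rewrite /real_sum; set f := fun t => u t - v t.
pose p t := Num.max (f t) 0; pose q t := Num.max (- f t) 0.
have p0 t : 0 <= p t by rewrite le_max lexx orbT.
have q0 t : 0 <= q t by rewrite le_max lexx orbT.
have -> : (\esum_(t in [set: T]) (EFin \o f)^\+ t = nneg_sum p)%E.
  by apply: eq_esum => t _; rewrite funeposE/= -EFin_max.
have -> : (\esum_(t in [set: T]) (EFin \o f)^\- t = nneg_sum q)%E.
  by apply: eq_esum => t _; rewrite funenegE/= -EFin_max.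
have pq t : p t - q t = f t.
  by rewrite /p /q max_sub_maxN.
have pu : forall t, p t <= u t.
  by move=> t; rewrite /p ge_max u0 andbT /f gerBl.
have qv : forall t, q t <= v t.
  by move=> t; rewrite /q ge_max v0 andbT /f opprB gerBl.
have poo := le_lt_trans (le_nneg_sum pu) uoo.
have qoo := le_lt_trans (le_nneg_sum qv) voo.
have : (nneg_sum p + nneg_sum v = nneg_sum u + nneg_sum q)%E.
  rewrite -!nneg_sumD//; apply: eq_esum => t _; congr (_%:E).
  by apply/eqP; rewrite -subr_eq addrAC pq subrK.
have [pf qf uf vf] : [/\ nneg_sum p \is a fin_num, nneg_sum q \is a fin_num,
    nneg_sum u \is a fin_num & nneg_sum v \is a fin_num] by split; exact: nneg_sum_fin.
rewrite -(fineK pf) -(fineK qf) -(fineK uf) -(fineK vf) -!EFinD => -[H] /=.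
by apply/eqP; rewrite subr_eq addrAC -H addrK.
Qed.

Lemma real_sum_posneg f : abs_summable f -> exists u v,
  [/\ (forall t, 0 <= u t), (forall t, 0 <= v t), (nneg_sum u < +oo)%E,
      (nneg_sum v < +oo)%E & f = fun t => u t - v t].
Proof.
move=> sf; exists (fun t => Num.max (f t) 0), (fun t => Num.max (- f t) 0).
split=> [t|t|||].
- by rewrite le_max lexx orbT.
- by rewrite le_max lexx orbT.
- apply: le_lt_trans sf; apply: le_nneg_sum => t.
  by rewrite ge_max normr_ge0 ler_norm.
- apply: le_lt_trans sf; apply: le_nneg_sum => t.
  by rewrite ge_max normr_ge0 -normrN ler_norm.
- by apply/funext => t; rewrite max_sub_maxN.
Qed.

Lemma real_sumD f g : abs_summable f -> abs_summable g ->
  real_sum (fun t => f t + g t) = real_sum f + real_sum g.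
Proof.
move=> /real_sum_posneg[u [v [u0 v0 uoo voo ->]]].
move=> /real_sum_posneg[u' [v' [u'0 v'0 u'oo v'oo ->]]].
have -> : (fun t => u t - v t + (u' t - v' t)) =
          (fun t => (u t + u' t) - (v t + v' t)).
  by apply/funext => t; rewrite opprD addrACA.
rewrite !real_sum_sub//.
- by rewrite !nneg_sumD// !fineD ?nneg_sum_fin// opprD addrACA.
- by move=> t; rewrite addr_ge0.
- by move=> t; rewrite addr_ge0.
- by rewrite nneg_sumD// lte_add_pinfty.
- by rewrite nneg_sumD// lte_add_pinfty.
Qed.

Lemma real_sumZ c f : abs_summable f ->
  real_sum (fun t => c * f t) = c * real_sum f.
Proof.
have pos d u v : 0 <= d -> (forall t, 0 <= u t) -> (forall t, 0 <= v t) ->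
    (nneg_sum u < +oo)%E -> (nneg_sum v < +oo)%E ->
    real_sum (fun t => d * (u t - v t)) = d * real_sum (fun t => u t - v t).
  move=> d0 u0 v0 uoo voo.
  have -> : (fun t => d * (u t - v t)) = (fun t => d * u t - d * v t).
    by apply/funext => t; rewrite mulrBr.
  rewrite !real_sum_sub ?nneg_sumZ//.
  - by rewrite !fineM ?nneg_sum_fin// mulrBr.
  - by move=> t; rewrite mulr_ge0.
  - by move=> t; rewrite mulr_ge0.
  - by rewrite -(fineK (nneg_sum_fin _ uoo))// -EFinM ltry.
  - by rewrite -(fineK (nneg_sum_fin _ voo))// -EFinM ltry.
move=> /real_sum_posneg[u [v [u0 v0 uoo voo ->]]].
have [c0|c0] := leP 0 c; first exact: pos.
have -> : (fun t => c * (u t - v t)) = (fun t => (- c) * (v t - u t)).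
  by apply/funext => t; rewrite -[v t - _]opprB mulrNN.
rewrite pos// ?oppr_ge0 ?ltW// !real_sum_sub//.
by rewrite -mulrNN opprK opprB.
Qed.

Lemma nneg_sum_reindex (e : T -> T) u : bijective e ->
  nneg_sum (u \o e) = nneg_sum u.
Proof.
move=> be; symmetry; apply: (@reindex_esum R T T setT setT e).
by rewrite setTT_bijective.
Qed.

Lemma real_sum_reindex (e : T -> T) f : bijective e -> abs_summable f ->
  real_sum (f \o e) = real_sum f.
Proof.
move=> be /real_sum_posneg[u [v [u0 v0 uoo voo ->]]].
have -> : (fun t => u t - v t) \o e = fun t => (u \o e) t - (v \o e) t by [].
rewrite !real_sum_sub ?nneg_sum_reindex//.
all: by move=> t /=.
Qed.

Lemma real_sum0 : real_sum (fun _ : T => 0 : R) = 0.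
Proof.
by rewrite real_sum_pos// /nneg_sum esum1.
Qed.

Lemma real_sum_point f t0 : (forall t, t != t0 -> f t = 0) -> real_sum f = f t0.
Proof.
move=> f0.
have pos c : 0 <= c -> real_sum (fun t => if t == t0 then c else 0) = c.
  move=> c0; rewrite real_sum_pos; last by move=> t; case: eqP.
  have -> : nneg_sum (fun t => if t == t0 then c else 0) = c%:E; last by [].
  apply/eqP; rewrite eq_le; apply/andP; split.
    apply: (proj2 (nneg_sum_leP _ _)) => [t|s us]; first by case: eqP.
    case: (boolP (t0 \in s)) => h.
      rewrite (bigD1_seq t0)//= eqxx big1 ?addr0// => t /negPf -> //.
    rewrite big_seq big1// => t ts; case: eqP => // tt.
    by rewrite -tt ts in h.
  have := @nneg_sum_ge (fun t => if t == t0 then c else 0) t0; rewrite eqxx; apply.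
  by move=> t; case: eqP.
have sm c : abs_summable (fun t => if t == t0 then c else 0).
  have p c' : 0 <= c' -> (nneg_sum (fun t => if t == t0 then c' else 0)%R < +oo)%E.
    move=> c0; apply: (@le_lt_trans _ _ c'%:E); last exact: ltry.
    apply: (proj2 (nneg_sum_leP _ _)) => [t|s us]; first by case: eqP.
    case: (boolP (t0 \in s)) => h.
      rewrite (bigD1_seq t0)//= eqxx big1 ?addr0// => t /negPf -> //.
    rewrite big_seq big1// => t ts; case: eqP => // tt.
    by rewrite -tt ts in h.
  apply: (@abs_summable_le _ (fun t => if t == t0 then `|c| else 0)); last exact: p.
  by move=> t; case: eqP => //; rewrite normr0.
have -> : f = fun t => f t0 * (if t == t0 then 1 else 0).
  by apply/funext => t; case: eqP => [->|/eqP/f0 ->]; rewrite ?mulr1 ?mulr0.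
by rewrite real_sumZ// pos// eqxx.
Qed.

End real_families.

(** * Complex families, the inner product and the squared norm *)

Local Open Scope complex_scope.

Section complex_families.
Variables (R : realType) (T : choiceType).
Implicit Types (f g h : T -> R[i]) (c : R[i]).

Lemma sqr_normcE (z : R[i]) :
  Normc.normc z ^+ 2 = complex.Re z ^+ 2 + complex.Im z ^+ 2.
Proof. by case: z => a b /=; rewrite sqr_sqrtr// addr_ge0// sqr_ge0. Qed.

Lemma normc_ge0 (z : R[i]) : 0 <= Normc.normc z.
Proof. by case: z => a b; exact: sqrtr_ge0. Qed.

Lemma mul_conjc_normc (z : R[i]) : z * conjc z = (Normc.normc z ^+ 2)%:C.
Proof.
rewrite sqr_normcE; case: z => a b; apply/eqP.
by rewrite eq_complex/=; apply/andP; split; apply/eqP; ring.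
Qed.

Lemma normc_Re (z : R[i]) : `|complex.Re z| <= Normc.normc z.
Proof.
rewrite -(@ler_pXn2r _ 2)// ?nnegrE ?normc_ge0//.
by rewrite sqr_normcE real_normK ?num_real// lerDl sqr_ge0.
Qed.

Lemma normc_Im (z : R[i]) : `|complex.Im z| <= Normc.normc z.
Proof.
rewrite -(@ler_pXn2r _ 2)// ?nnegrE ?normc_ge0//.
by rewrite sqr_normcE real_normK ?num_real// lerDr sqr_ge0.
Qed.

Lemma normc_conj (z : R[i]) : Normc.normc (conjc z) = Normc.normc z.
Proof. by case: z => a b /=; rewrite sqrrN. Qed.

Definition abs_summablec f := (nneg_sum (fun t => Normc.normc (f t)) < +oo)%E.

Lemma abs_summable_Re f : abs_summablec f -> abs_summable (fun t => complex.Re (f t)).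
Proof. by move=> sf; apply: abs_summable_le sf => t; exact: normc_Re. Qed.

Lemma abs_summable_Im f : abs_summablec f -> abs_summable (fun t => complex.Im (f t)).
Proof. by move=> sf; apply: abs_summable_le sf => t; exact: normc_Im. Qed.

Lemma complex_sumD f g : abs_summablec f -> abs_summablec g ->
  complex_sum (fun t => f t + g t) = complex_sum f + complex_sum g.
Proof.
move=> sf sg; have ReD := real_sumD (abs_summable_Re sf) (abs_summable_Re sg).
have ImD := real_sumD (abs_summable_Im sf) (abs_summable_Im sg).
apply/eqP; rewrite eq_complex/= -ReD -ImD; apply/andP; split; apply/eqP.
  by congr real_sum; apply/funext => t; case: (f t) (g t) => [? ?] [? ?].
by congr real_sum; apply/funext => t; case: (f t) (g t) => [? ?] [? ?].
Qed.

Lemma complex_sumZ c f : abs_summablec f ->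
  complex_sum (fun t => c * f t) = c * complex_sum f.
Proof.
move=> sf; have sr := abs_summable_Re sf; have si := abs_summable_Im sf.
case: c => a b; rewrite /complex_sum.
have -> : (fun t => complex.Re ((a +i* b) * f t)) =
          (fun t => a * complex.Re (f t) + (- b) * complex.Im (f t)).
  by apply/funext => t; case: (f t) => x y /=; rewrite mulNr.
have -> : (fun t => complex.Im ((a +i* b) * f t)) =
          (fun t => a * complex.Im (f t) + b * complex.Re (f t)).
  by apply/funext => t; case: (f t) => x y /=.
rewrite !real_sumD ?real_sumZ//; try exact: abs_summableZ.
by apply/eqP; rewrite eq_complex/= mulNr !eqxx.
Qed.

Lemma complex_sum_conj f : abs_summablec f ->
  complex_sum (fun t => conjc (f t)) = conjc (complex_sum f).
Proof.
move=> sf; rewrite /complex_sum; apply/eqP; rewrite eq_complex/=.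
apply/andP; split; apply/eqP.
  by congr real_sum; apply/funext => t; case: (f t).
rewrite -mulN1r -real_sumZ; last exact: abs_summable_Im.
by congr real_sum; apply/funext => t; case: (f t) => x y /=; rewrite mulN1r.
Qed.

Lemma complex_sum_reindex (e : T -> T) f : bijective e -> abs_summablec f ->
  complex_sum (f \o e) = complex_sum f.
Proof.
move=> be sf; rewrite /complex_sum; congr Complex.
  exact: (real_sum_reindex be (abs_summable_Re sf)).
exact: (real_sum_reindex be (abs_summable_Im sf)).
Qed.

Lemma complex_sum_point f t0 : (forall t, t != t0 -> f t = 0) ->
  complex_sum f = f t0.
Proof.
move=> f0; rewrite /complex_sum !(@real_sum_point _ _ _ t0); first by case: (f t0).
  by move=> t /f0 ->.
by move=> t /f0 ->.
Qed.

(** [fine] sends an infinite sum to 0, so this is the squared norm only for square-summable [f]. *)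
Definition sqnorm f : R := fine (nneg_sum (fun t => Normc.normc (f t) ^+ 2)).

Lemma sqnorm_ge0 f : 0 <= sqnorm f.
Proof. by apply/fine_ge0/esum_ge0 => t _; rewrite lee_fin sqr_ge0. Qed.

Lemma ell2P f : ell2 f <-> (nneg_sum (fun t => Normc.normc (f t) ^+ 2)%R < +oo)%E.
Proof. by []. Qed.

Lemma ell2_sqnormE f : ell2 f ->
  nneg_sum (fun t => Normc.normc (f t) ^+ 2) = (sqnorm f)%:E.
Proof.
by move=> lf; rewrite /sqnorm fineK// nneg_sum_fin// => t; rewrite sqr_ge0.
Qed.

(** Summability and the norm bound come together from finite partial sums; sums, point masses and
    limits are all handled this way. *)
Lemma ell2_bound f M : (forall s : seq T, uniq s ->
  \sum_(t <- s) Normc.normc (f t) ^+ 2 <= M) -> ell2 f /\ sqnorm f <= M.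
Proof.
move=> H; have n0 t : 0 <= Normc.normc (f t) ^+ 2 by rewrite sqr_ge0.
have h : (nneg_sum (fun t => Normc.normc (f t) ^+ 2)%R <= M%:E)%E.
  exact: (proj2 (nneg_sum_leP _ n0)).
have lf : ell2 f by apply/ell2P; apply: (le_lt_trans h); rewrite ltry.
by split => //; rewrite -lee_fin -ell2_sqnormE.
Qed.

Lemma ell2_seq_le f s : ell2 f -> uniq s ->
  \sum_(t <- s) Normc.normc (f t) ^+ 2 <= sqnorm f.
Proof.
move=> lf us; have n0 t : 0 <= Normc.normc (f t) ^+ 2 by rewrite sqr_ge0.
by apply: (proj1 (nneg_sum_leP _ n0)) => //; rewrite ell2_sqnormE.
Qed.

Lemma normc_le_sqnorm f t : ell2 f -> Normc.normc (f t) ^+ 2 <= sqnorm f.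
Proof.
move=> lf; rewrite -[leLHS](big_seq1 +%R t (fun t => Normc.normc (f t) ^+ 2)).
by rewrite ell2_seq_le.
Qed.

Lemma sqnorm_eq0 f : ell2 f -> sqnorm f = 0 -> f = 0.
Proof.
move=> lf f0; apply/funext => t; apply/Normc.eq0_normc/eqP.
by rewrite -sqrf_eq0 eq_le sqr_ge0 andbT -f0 normc_le_sqnorm.
Qed.

(** Pointwise |a + b|^2 <= 2 |a|^2 + 2 |b|^2. The lost constant is harmless, and square roots of
    norms are avoided. *)
Lemma sqnorm_Dle f g : ell2 f -> ell2 g ->
  ell2 (fun t => f t + g t) /\ sqnorm (fun t => f t + g t) <= 2 * sqnorm f + 2 * sqnorm g.
Proof.
move=> lf lg; apply: ell2_bound => s us.
apply: (@le_trans _ _ (\sum_(t <- s)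
    (2 * Normc.normc (f t) ^+ 2 + 2 * Normc.normc (g t) ^+ 2))).
  apply: ler_sum => t _; rewrite !sqr_normcE; case: (f t) (g t) => [a b] [a' b'] /=.
  by have := sqr_ge0 (a - a'); have := sqr_ge0 (b - b'); nra.
by rewrite big_split/= -!mulr_sumr lerD// ler_wpM2l// ell2_seq_le.
Qed.

Lemma ell2D f g : ell2 f -> ell2 g -> ell2 (fun t => f t + g t).
Proof. by move=> lf lg; case: (sqnorm_Dle lf lg). Qed.

Lemma sqnormZ c f : ell2 f ->
  sqnorm (fun t => c * f t) = Normc.normc c ^+ 2 * sqnorm f.
Proof.
move=> lf; rewrite /sqnorm.
have -> : (fun t => Normc.normc (c * f t) ^+ 2) =
          (fun t => Normc.normc c ^+ 2 * Normc.normc (f t) ^+ 2).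
  by apply/funext => t; rewrite Normc.normcM exprMn.
rewrite nneg_sumZ ?sqr_ge0// => [|t]; last exact: sqr_ge0.
by rewrite ell2_sqnormE.
Qed.

Lemma sqnorm_comp (e : T -> T) f : bijective e -> sqnorm (f \o e) = sqnorm f.
Proof.
by move=> be; rewrite /sqnorm (@nneg_sum_reindex _ _ e (fun t => Normc.normc (f t) ^+ 2)).
Qed.

Lemma ell2Z c f : ell2 f -> ell2 (fun t => c * f t).
Proof.
move=> lf; apply/ell2P.
have -> : (fun t => Normc.normc (c * f t) ^+ 2) =
          (fun t => Normc.normc c ^+ 2 * Normc.normc (f t) ^+ 2).
  by apply/funext => t; rewrite Normc.normcM exprMn.
by rewrite nneg_sumZ ?sqr_ge0// => [|t]; rewrite ?sqr_ge0// ell2_sqnormE// -EFinM ltry.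
Qed.

Lemma ell20 : ell2 (fun _ : T => 0 : R[i]).
Proof.
have [] // := @ell2_bound (fun=> 0) 0.
by move=> s _; rewrite big1// => t _; rewrite Normc.normc0 expr0n.
Qed.

Lemma ell2_comp (e : T -> T) f : bijective e -> ell2 f -> ell2 (f \o e).
Proof.
move=> be /ell2P lf; apply/ell2P.
by rewrite (@nneg_sum_reindex _ _ e (fun t => Normc.normc (f t) ^+ 2)).
Qed.

Lemma abs_summablec_mul f g : ell2 f -> ell2 g ->
  abs_summablec (fun t => f t * conjc (g t)).
Proof.
move=> lf lg.
apply: (@le_lt_trans _ _ (nneg_sum
  (fun t => Normc.normc (f t) ^+ 2 + Normc.normc (g t) ^+ 2)%R))%E.
  apply: le_nneg_sum => t; rewrite Normc.normcM normc_conj.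
  have := normc_ge0 (f t); have := normc_ge0 (g t).
  by have := sqr_ge0 (Normc.normc (f t) - Normc.normc (g t)); nra.
by rewrite nneg_sumD ?lte_add_pinfty// => t; rewrite sqr_ge0.
Qed.

Lemma ell2_dotDl f g h : ell2 f -> ell2 g -> ell2 h ->
  ell2_dot (fun t => f t + g t) h = ell2_dot f h + ell2_dot g h.
Proof.
move=> lf lg lh; rewrite /ell2_dot -complex_sumD; try exact: abs_summablec_mul.
by congr complex_sum; apply/funext => t; rewrite mulrDl.
Qed.

Lemma ell2_dotZl c f g : ell2 f -> ell2 g ->
  ell2_dot (fun t => c * f t) g = c * ell2_dot f g.
Proof.
move=> lf lg; rewrite /ell2_dot -complex_sumZ; last exact: abs_summablec_mul.
by congr complex_sum; apply/funext => t; rewrite mulrA.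
Qed.

Lemma ell2_dotC f g : ell2 f -> ell2 g -> ell2_dot g f = conjc (ell2_dot f g).
Proof.
move=> lf lg; rewrite /ell2_dot -complex_sum_conj; last exact: abs_summablec_mul.
by congr complex_sum; apply/funext => t; rewrite rmorphM/= conjcK mulrC.
Qed.

Lemma ell2_dotff f : ell2 f -> ell2_dot f f = (sqnorm f)%:C.
Proof.
move=> lf; rewrite /ell2_dot /complex_sum; congr Complex.
  rewrite /sqnorm -real_sum_pos; last by move=> t; exact: sqr_ge0.
  by congr real_sum; apply/funext => t; rewrite mul_conjc_normc.
rewrite -[RHS](@real_sum0 R T); congr real_sum.
by apply/funext => t; rewrite mul_conjc_normc.
Qed.

Lemma ell2_dot_comp (e e' : T -> T) f g : cancel e e' -> cancel e' e ->
  ell2 f -> ell2 g -> ell2_dot (f \o e) g = ell2_dot f (g \o e').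
Proof.
move=> ee' e'e lf lg.
have be : bijective e by exists e'.
have be' : bijective e' by exists e.
rewrite /ell2_dot -[RHS](complex_sum_reindex be); last first.
  by apply: abs_summablec_mul => //; exact: ell2_comp.
by congr complex_sum; apply/funext => t /=; rewrite ee'.
Qed.

Lemma ell2_dot_delta f t0 : ell2_dot f (fun t : T => (t == t0)%:R) = f t0.
Proof.
rewrite /ell2_dot (@complex_sum_point _ t0).
  by rewrite eqxx rmorph1 mulr1.
by move=> t /negPf ->; rewrite rmorph0 mulr0.
Qed.

Lemma ell2_delta (t0 : T) : ell2 (fun t : T => (t == t0)%:R : R[i]).
Proof.
have [] // := @ell2_bound (fun t : T => (t == t0)%:R) 1.
move=> s us; case: (boolP (t0 \in s)) => h.
  rewrite (bigD1_seq t0)//= eqxx Normc.normc1 expr1n big1 ?addr0// => t /negPf ->.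
  by rewrite Normc.normc0 expr0n.
rewrite big_seq big1 => [|t ts]; first by rewrite ler01.
case: eqP => [tt|_]; last by rewrite Normc.normc0 expr0n.
by rewrite -tt ts in h.
Qed.

End complex_families.

(** * The projection onto the kernel as a limit *)

Lemma ReB (R : realType) (z w : R[i]) :
  complex.Re (z - w) = complex.Re z - complex.Re w.
Proof. by case: z w => [a b] [a' b']. Qed.

Lemma ImB (R : realType) (z w : R[i]) :
  complex.Im (z - w) = complex.Im z - complex.Im w.
Proof. by case: z w => [a b] [a' b']. Qed.

Section ell2n.
Variables (R : realType) (d : nat) (T : choiceType).
Implicit Types (x y z : 'I_d -> T -> R[i]) (c : R[i]).

Definition vscale c x : 'I_d -> T -> R[i] := fun i t => c * x i t.

Definition sqnormn x : R := \sum_i sqnorm (x i).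

Lemma sqnormn_ge0 x : 0 <= sqnormn x.
Proof. by apply: sumr_ge0 => i _; exact: sqnorm_ge0. Qed.

Lemma ell2nD x y : ell2n x -> ell2n y -> ell2n (x + y).
Proof. by move=> lx ly i; exact: ell2D. Qed.

Lemma ell2nZ c x : ell2n x -> ell2n (vscale c x).
Proof. by move=> lx i; exact: ell2Z. Qed.

Lemma vscaleN1 x : vscale (-1) x = - x.
Proof. by apply/funext => i; apply/funext => t; rewrite /vscale mulN1r. Qed.

Lemma ell2nN x : ell2n x -> ell2n (- x).
Proof. by rewrite -vscaleN1; exact: ell2nZ. Qed.

Lemma ell2nB x y : ell2n x -> ell2n y -> ell2n (x - y).
Proof. by move=> lx ly; apply: ell2nD => //; exact: ell2nN. Qed.

Lemma ell2n_dotDl x y z : ell2n x -> ell2n y -> ell2n z ->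
  ell2n_dot (x + y) z = ell2n_dot x z + ell2n_dot y z.
Proof.
by move=> lx ly lz; rewrite -big_split; apply: eq_bigr => i _; exact: ell2_dotDl.
Qed.

Lemma ell2n_dotZl c x y : ell2n x -> ell2n y ->
  ell2n_dot (vscale c x) y = c * ell2n_dot x y.
Proof.
by move=> lx ly; rewrite [RHS]mulr_sumr; apply: eq_bigr => i _; exact: ell2_dotZl.
Qed.

Lemma ell2n_dotC x y : ell2n x -> ell2n y -> ell2n_dot y x = conjc (ell2n_dot x y).
Proof.
by move=> lx ly; rewrite [RHS]rmorph_sum; apply: eq_bigr => i _; exact: ell2_dotC.
Qed.

Lemma ell2n_dotNl x y : ell2n x -> ell2n y -> ell2n_dot (- x) y = - ell2n_dot x y.
Proof. by move=> lx ly; rewrite -vscaleN1 ell2n_dotZl// mulN1r. Qed.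

Lemma ell2n_dotBl x y z : ell2n x -> ell2n y -> ell2n z ->
  ell2n_dot (x - y) z = ell2n_dot x z - ell2n_dot y z.
Proof. by move=> lx ly lz; rewrite ell2n_dotDl ?ell2n_dotNl//; exact: ell2nN. Qed.

Lemma ell2n_dotDr x y z : ell2n x -> ell2n y -> ell2n z ->
  ell2n_dot z (x + y) = ell2n_dot z x + ell2n_dot z y.
Proof.
move=> lx ly lz; rewrite ell2n_dotC ?ell2n_dotDl//; last exact: ell2nD.
by rewrite rmorphD /= -!ell2n_dotC.
Qed.

Lemma ell2n_dotZr c x y : ell2n x -> ell2n y ->
  ell2n_dot y (vscale c x) = conjc c * ell2n_dot y x.
Proof.
move=> lx ly; rewrite ell2n_dotC ?ell2n_dotZl//; last exact: ell2nZ.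
by rewrite rmorphM /= -!ell2n_dotC.
Qed.

Lemma ell2n_dotBr x y z : ell2n x -> ell2n y -> ell2n z ->
  ell2n_dot z (x - y) = ell2n_dot z x - ell2n_dot z y.
Proof.
move=> lx ly lz; rewrite ell2n_dotC ?ell2n_dotBl//; last exact: ell2nB.
by rewrite rmorphB /= -!ell2n_dotC.
Qed.

Lemma ell2n_dotxx x : ell2n x -> ell2n_dot x x = (sqnormn x)%:C.
Proof. by move=> lx; rewrite [RHS]rmorph_sum; apply: eq_bigr => i _; exact: ell2_dotff. Qed.

Lemma sqnormnE x : ell2n x -> sqnormn x = complex.Re (ell2n_dot x x).
Proof. by move=> lx; rewrite ell2n_dotxx. Qed.

Lemma sqnormnB x y : ell2n x -> ell2n y ->
  sqnormn (x - y) = sqnormn x - 2 * complex.Re (ell2n_dot x y) + sqnormn y.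
Proof.
move=> lx ly; have lxy := ell2nB lx ly.
rewrite !sqnormnE// ell2n_dotBl// !ell2n_dotBr// (ell2n_dotC lx ly).
case: (ell2n_dot x x) (ell2n_dot x y) (ell2n_dot y y) => [a b] [a' b'] [a'' b''] /=.
by ring.
Qed.

Lemma sqnormn_Dle x y : ell2n x -> ell2n y ->
  sqnormn (x + y) <= 2 * sqnormn x + 2 * sqnormn y.
Proof.
move=> lx ly; have h1 := sqnormn_ge0 (x - y); move: h1; rewrite sqnormnB//.
rewrite (sqnormnE (ell2nD lx ly)) ell2n_dotDl ?ell2n_dotDr//; try exact: ell2nD.
rewrite (ell2n_dotC lx ly) (ell2n_dotxx lx) (ell2n_dotxx ly).
by case: (ell2n_dot x y) => [a b] /=; lra.
Qed.

Lemma sqnormnZ c x : ell2n x -> sqnormn (vscale c x) = Normc.normc c ^+ 2 * sqnormn x.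
Proof.
move=> lx; have lcx := ell2nZ c lx.
rewrite (sqnormnE lcx) ell2n_dotZl ?ell2n_dotZr// mulrA mul_conjc_normc ell2n_dotxx//.
by rewrite -(rmorphM (real_complex R)).
Qed.

Lemma normc_le_sqnormn x i t : ell2n x -> Normc.normc (x i t) ^+ 2 <= sqnormn x.
Proof.
move=> lx; apply: le_trans (normc_le_sqnorm _ (lx i)) _.
by rewrite /sqnormn (bigD1 i)//= lerDl sumr_ge0// => j _; exact: sqnorm_ge0.
Qed.

Lemma sqnormn_eq0 x : ell2n x -> sqnormn x = 0 -> x = 0.
Proof.
move=> lx x0; apply/funext => i; apply/sqnorm_eq0 => //.
by apply/eqP; rewrite eq_le sqnorm_ge0 andbT -x0 /sqnormn (bigD1 i)//= lerDl
  sumr_ge0// => j _; exact: sqnorm_ge0.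
Qed.

(* Fatou for the counting measure, with the non-optimal factor d. *)
Lemma ell2n_limit (x_ : nat -> 'I_d -> T -> R[i]) x M :
  (forall k, ell2n (x_ k)) -> (forall k, sqnormn (x_ k) <= M) ->
  (forall i t, (fun k => complex.Re (x_ k i t)) @ \oo --> complex.Re (x i t)) ->
  (forall i t, (fun k => complex.Im (x_ k i t)) @ \oo --> complex.Im (x i t)) ->
  ell2n x /\ sqnormn x <= d%:R * M.
Proof.
move=> lx xM cRe cIm.
suff H i : ell2 (x i) /\ sqnorm (x i) <= M.
  split; first by move=> i; case: (H i).
  rewrite mulr_natl -[d in _ *+ d]card_ord -sumr_const.
  by apply: ler_sum => i _; case: (H i).
apply: ell2_bound => s us.
have cs : (fun k => \sum_(t <- s) Normc.normc (x_ k i t) ^+ 2) @ \oo -->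
    \sum_(t <- s) Normc.normc (x i t) ^+ 2.
  elim: s {us} => [|t s IH].
    by rewrite big_nil; under eq_fun do rewrite big_nil; exact: cvg_cst.
  rewrite big_cons; under eq_fun do rewrite big_cons.
  apply: cvgD => //; rewrite sqr_normcE; under eq_fun do rewrite sqr_normcE.
  by apply: cvgD; apply: cvgM.
apply: (closed_cvg _ (@closed_le R M) _ _ cs).
apply: nearW => k /=.
apply: (@le_trans _ _ (sqnorm (x_ k i))); first exact: (ell2_seq_le (lx k i) us).
apply: le_trans (xM k).
by rewrite /sqnormn (bigD1 i)//= lerDl sumr_ge0// => j _; exact: sqnorm_ge0.
Qed.

End ell2n.

Section kernel_projection.
Variables (R : realType) (d : nat) (T : choiceType).
Local Notation V := ('I_d -> T -> R[i]).
Variables (F Fa : V -> V) (K : R).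
Hypothesis K0 : 0 < K.
Hypothesis F_ell2 : forall x, ell2n x -> ell2n (F x).
Hypothesis Fa_ell2 : forall x, ell2n x -> ell2n (Fa x).
Hypothesis F_linear : forall c x y, F (vscale c x + y) = vscale c (F x) + F y.
Hypothesis Fa_0 : Fa 0 = 0.
Hypothesis F_adjoint : forall x y, ell2n x -> ell2n y ->
  ell2n_dot (F x) y = ell2n_dot x (Fa y).
Hypothesis F_bound : forall x, ell2n x -> sqnormn (F x) <= K * sqnormn x.
Hypothesis Fa_bound : forall x, ell2n x -> sqnormn (Fa x) <= K * sqnormn x.

(** The two bounds on squared norms give [Fa] after [F] norm at most [K]. On square-summable vectors
    this operator thus lies between 0 and 1, and its fixed vectors form the kernel of [F]. *)
Definition gram_contraction (x : V) : V := x - vscale (K^-1)%:C (Fa (F x)).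
Local Notation S := gram_contraction.

Let kerF : set V := [set x | ell2n x /\ F x = 0].

Let vscale1 (x : V) : vscale 1 x = x.
Proof. by apply/funext => i; apply/funext => t; rewrite /vscale mul1r. Qed.

Let F_D x y : F (x + y) = F x + F y.
Proof. by have := F_linear 1 x y; rewrite !vscale1. Qed.

Let F_0 : F 0 = 0.
Proof. by apply: (addrI (F 0)); rewrite -F_D !addr0. Qed.

Let F_N x : F (- x) = - F x.
Proof. by have := F_linear (-1) x 0; rewrite !vscaleN1 F_0 !addr0. Qed.

Let S_ell2 x : ell2n x -> ell2n (S x).
Proof. by move=> lx; apply: ell2nB => //; apply/ell2nZ/Fa_ell2/F_ell2. Qed.

Let Sk_ell2 k x : ell2n x -> ell2n (iter k S x).
Proof. by move=> lx; elim: k => //= k IH; exact: S_ell2. Qed.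

Let S_self x y : ell2n x -> ell2n y -> ell2n_dot (S x) y = ell2n_dot x (S y).
Proof.
move=> lx ly; have lFx := F_ell2 lx; have lFy := F_ell2 ly.
have lFFx := Fa_ell2 lFx; have lFFy := Fa_ell2 lFy.
rewrite ell2n_dotBl ?ell2n_dotBr//; try exact: ell2nZ.
rewrite ell2n_dotZl// ell2n_dotZr// conjc_real; congr (_ - _ * _).
by rewrite -F_adjoint// [LHS]ell2n_dotC// -F_adjoint// -ell2n_dotC.
Qed.

Let Sk_self k x y : ell2n x -> ell2n y ->
  ell2n_dot (iter k S x) y = ell2n_dot x (iter k S y).
Proof.
move=> lx ly; elim: k y ly => [//|k IH] y ly.
by rewrite iterS S_self ?IH -?iterSr//; [exact: S_ell2|exact: Sk_ell2].
Qed.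

(** Expanding the square gives |x|^2 - 2 |F x|^2 / K + |Fa F x|^2 / K^2, and the bound on [Fa] makes
    the last term at most |F x|^2 / K. So the norms of the iterates decrease, and each decrease
    controls [F] at the iterate. *)
Let S_decr x : ell2n x -> sqnormn (S x) <= sqnormn x - K^-1 * sqnormn (F x).
Proof.
move=> lx; have lFx := F_ell2 lx; have lFFx := Fa_ell2 lFx.
rewrite sqnormnB//; last exact: ell2nZ.
rewrite ell2n_dotZr// conjc_real -F_adjoint// ell2n_dotxx// sqnormnZ//.
have -> : Normc.normc (K^-1)%:C ^+ 2 = K^-1 ^+ 2.
  by rewrite sqr_normcE/= expr0n addr0.
rewrite -(rmorphM (real_complex R))/=.
have e : K^-1 ^+ 2 * K = K^-1 by rewrite expr2 -mulrA mulVf ?mulr1// gt_eqF.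
have := ler_wpM2l (sqr_ge0 K^-1) (Fa_bound lFx); rewrite mulrA e.
lra.
Qed.

Variable x0 : V.
Hypothesis lx0 : ell2n x0.

Let b k := sqnormn (iter k S x0).

Let b_ge0 k : 0 <= b k. Proof. exact: sqnormn_ge0. Qed.

Let b_step k : K^-1 * sqnormn (F (iter k S x0)) <= b k - b k.+1.
Proof. by have := S_decr (Sk_ell2 k lx0); rewrite /b iterS; lra. Qed.

Let b_decr k l : (k <= l)%N -> b l <= b k.
Proof.
move/subnK => <-; elim: (l - k)%N => // m; rewrite addSn.
have := b_step (m + k); have : 0 <= K^-1 * sqnormn (F (iter (m + k) S x0)).
  by rewrite mulr_ge0 ?sqnormn_ge0// invr_ge0 ltW.
lra.
Qed.

Let b_cauchy e : 0 < e -> exists N, forall k l, (N <= k)%N -> (N <= l)%N ->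
  b k - b l <= e.
Proof.
move=> e0.
have cb : cvgn b.
  apply: nonincreasing_is_cvgn.
    by apply/nonincreasing_seqP => n; exact: b_decr.
  by exists 0 => _ [n _ <-].
have /cvgrPdist_le /(_ e e0) [N _ HN] := cb.
exists N => k l Nk Nl.
apply: (@le_trans _ _ (b N - limn b)); last first.
  by have := HN N (leqnn _); rewrite distrC; exact: le_trans (ler_norm _).
by rewrite lerB ?b_decr//; exact: (nonincreasing_cvgn_ge (b_decr) cb l).
Qed.

(** Even exponents, because self-adjointness of S gives <S^(2k) x0, S^(2l) x0> = |S^(k+l) x0|^2:
    distances between these iterates are expressed by the convergent sequence [b] alone. *)
Let xk k := iter (k + k) S x0.
Let lxk k : ell2n (xk k). Proof. exact: Sk_ell2. Qed.

Let xk_dist k l : sqnormn (xk k - xk l) = b (k + k) - 2 * b (k + l) + b (l + l).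
Proof.
rewrite sqnormnB// -[sqnormn (xk k)]/(b (k + k)) -[sqnormn (xk l)]/(b (l + l)).
congr (_ - _ * _ + _).
have -> : ell2n_dot (xk k) (xk l) = ell2n_dot (iter (k + l) S x0) (iter (k + l) S x0).
  rewrite /xk (Sk_self (k + k) lx0 (Sk_ell2 (l + l) lx0)).
  by rewrite (Sk_self (k + l) lx0 (Sk_ell2 (k + l) lx0)) -!iterD addnACA.
by rewrite /b -sqnormnE//; exact: Sk_ell2.
Qed.

Let xk_cauchy e : 0 < e -> exists N, forall k l, (N <= k)%N -> (N <= l)%N ->
  sqnormn (xk k - xk l) <= e.
Proof.
move=> e0; have [N HN] := b_cauchy (divr_gt0 e0 (ltr0n R 2)).
exists N => k l Nk Nl; rewrite xk_dist.
have Na m n : (N <= m)%N -> (N <= m + n)%N by move/leq_trans; apply; exact: leq_addr.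
have := HN _ _ (Na _ k Nk) (Na _ l Nk); have := HN _ _ (Na _ l Nl) (Na _ l Nk); lra.
Qed.

Let p : V := fun i t => limn (fun k => complex.Re (xk k i t)) +i*
                        limn (fun k => complex.Im (xk k i t)).

Let cvg_coord (g : R[i] -> R) i t : (forall z, `|g z| <= Normc.normc z) ->
  (forall z w, g (z - w) = g z - g w) -> cvgn (fun k => g (xk k i t)).
Proof.
move=> gle gB; apply/cauchy_cvgP/cauchyP => e /= e0.
have [N HN] := xk_cauchy (exprn_gt0 2 (divr_gt0 e0 (ltr0n R 2))).
exists (g (xk N i t)); exists N => // k /= Nk.
rewrite /ball/= -gB (le_lt_trans (gle _))//.
apply: (@le_lt_trans _ _ (e / 2)); last lra.
have e20 : 0 <= e / 2 by lra.
rewrite -(@ler_pXn2r _ 2)// ?nnegrE ?normc_ge0//.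
apply: le_trans _ (HN N k (leqnn _) Nk).
exact: (normc_le_sqnormn i t (ell2nB (lxk N) (lxk k))).
Qed.

Let cvgRe i t : (fun k => complex.Re (xk k i t)) @ \oo --> complex.Re (p i t).
Proof. by apply: cvg_coord => [z|]; [exact: normc_Re|exact: ReB]. Qed.

Let cvgIm i t : (fun k => complex.Im (xk k i t)) @ \oo --> complex.Im (p i t).
Proof. by apply: cvg_coord => [z|]; [exact: normc_Im|exact: ImB]. Qed.

(** Coordinatewise convergence becomes convergence in norm by applying [ell2n_limit] to the
    differences with later iterates. Dividing [e] by d + 1 absorbs its factor [d], also for d =
    0. *)
Let xk_lim e : 0 < e -> exists N, forall k, (N <= k)%N ->
  ell2n (xk k - p) /\ sqnormn (xk k - p) <= e.
Proof.
move=> e0; have d0 : 0 < d%:R + 1 :> R by rewrite ltr_wpDl.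
have [N HN] := xk_cauchy (divr_gt0 e0 d0).
exists N => k Nk.
have [] := @ell2n_limit R d T (fun l => xk k - xk (l + N)%N) (xk k - p) (e / (d%:R + 1)).
- by move=> l; exact: ell2nB.
- by move=> l; apply: HN => //; exact: leq_addl.
- move=> i t.
  have -> : (fun l => complex.Re ((xk k - xk (l + N)%N) i t)) =
     (fun l => complex.Re (xk k i t) - complex.Re (xk (l + N)%N i t)).
    by apply/funext => l; exact: ReB.
  have -> : complex.Re ((xk k - p) i t) = complex.Re (xk k i t) - complex.Re (p i t).
    exact: ReB.
  apply: cvgB; first exact: cvg_cst.
  by rewrite (cvg_shiftn N (fun l => complex.Re (xk l i t))).
- move=> i t.
  have -> : (fun l => complex.Im ((xk k - xk (l + N)%N) i t)) =
     (fun l => complex.Im (xk k i t) - complex.Im (xk (l + N)%N i t)).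
    by apply/funext => l; exact: ImB.
  have -> : complex.Im ((xk k - p) i t) = complex.Im (xk k i t) - complex.Im (p i t).
    exact: ImB.
  apply: cvgB; first exact: cvg_cst.
  by rewrite (cvg_shiftn N (fun l => complex.Im (xk l i t))).
move=> lx le; split => //; apply: (le_trans le).
rewrite mulrCA; apply: ler_piMr; first exact: ltW.
by rewrite ler_pdivrMr// mul1r lerDl ler01.
Qed.

Let p_ell2 : ell2n p.
Proof.
have [N HN] := xk_lim ltr01; have [lxp _] := HN N (leqnn _).
have -> : p = xk N - (xk N - p) by rewrite opprB addrC subrK.
exact: ell2nB.
Qed.

Let Fp : F p = 0.
Proof.
apply: sqnormn_eq0; first exact: F_ell2.
apply/eqP; rewrite eq_le sqnormn_ge0 andbT; apply/ler_addgt0Pr => e e0.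
(* F p is split into F at an iterate and F at the error; each has squared norm at most K e' = e / 4,
   and the inequality for sums doubles both. *)
rewrite add0r; set e' := e / (4 * K).
have e'0 : 0 < e' by rewrite divr_gt0// mulr_gt0.
have Ke' : K * e' = e / 4 by rewrite /e'; field; rewrite gt_eqF.
have [N HN] := xk_lim e'0; have [N' HN'] := b_cauchy e'0.
set k := maxn N N'.
have [lxp xp] := HN k (leq_maxl _ _).
have bk := HN' (k + k)%N (k + k).+1.
have lxpF := F_ell2 lxp.
have -> : F p = F (xk k) + - F (xk k - p).
  by rewrite F_D F_N opprD opprK addrA subrr add0r.
apply: (le_trans (sqnormn_Dle _ _)); [exact: F_ell2|exact: ell2nN|].
have -> : sqnormn (- F (xk k - p)) = sqnormn (F (xk k - p)).
  by rewrite -vscaleN1 sqnormnZ// sqr_normcE/= oppr0 expr0n addr0 sqrrN expr1n mul1r.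
have h1 : sqnormn (F (xk k)) <= K * e'.
  rewrite -ler_pdivrMl//; apply: le_trans (b_step _) _; apply: bk.
    by rewrite /k; lia.
  by rewrite /k; lia.
have h2 : sqnormn (F (xk k - p)) <= K * e'.
  by apply: le_trans (F_bound lxp) _; rewrite ler_pM2l.
by rewrite Ke' in h1 h2; lra.
Qed.

Let S_ker z : F z = 0 -> S z = z.
Proof.
move=> Fz; rewrite /S Fz Fa_0; apply/funext => i; apply/funext => t.
by rewrite -[LHS]/(z i t - K^-1%:C * 0) mulr0 subr0.
Qed.

Let Sk_ker k z : F z = 0 -> iter k S z = z.
Proof. by move=> Fz; elim: k => //= k ->; exact: S_ker. Qed.

(** S is self-adjoint and fixes [z], so x0 may be replaced by any even iterate, and these tend to
    [p] in norm. *)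
Let p_orth z : kerF z -> ell2n_dot (x0 - p) z = 0.
Proof.
move=> [lz Fz]; set c := ell2n_dot (x0 - p) z.
have lx0p : ell2n (x0 - p) by exact: ell2nB.
have cE k : ell2n (xk k - p) -> c = ell2n_dot (xk k - p) z.
  move=> lxp; rewrite /c !ell2n_dotBl//; congr (_ - _).
  by rewrite Sk_self// Sk_ker.
(* A substitute for Cauchy-Schwarz: it expands the squared norm of [z] minus a multiple of the error
   vector [r], whose own squared norm is at most [e]. *)
have c2 s e : 0 < s -> 0 < e -> 2 * s * Normc.normc c ^+ 2 <=
    sqnormn z + s ^+ 2 * Normc.normc c ^+ 2 * e.
  move=> s0 e0; have [N HN] := xk_lim e0; have [lr re] := HN N (leqnn _).
  set r := xk N - p in lr re.
  have := sqnormn_ge0 (z - vscale (s%:C * conjc c) r).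
  have lcr := ell2nZ (s%:C * conjc c) lr.
  rewrite sqnormnB// ell2n_dotZr// sqnormnZ//.
  have -> : conjc (s%:C * conjc c) * ell2n_dot z r = (s * Normc.normc c ^+ 2)%:C.
    have conj_scale w : conjc (s%:C * conjc w) = s%:C * w.
      apply/eqP; case: w => u v; rewrite eq_complex/=.
      by apply/andP; split; apply/eqP; ring.
    rewrite conj_scale (ell2n_dotC lr lz) -(cE N lr).
    by rewrite -mulrA mul_conjc_normc -(rmorphM (real_complex R)).
  rewrite Normc.normcM normc_conj exprMn.
  have -> : Normc.normc s%:C ^+ 2 = s ^+ 2 by rewrite sqr_normcE/= expr0n addr0.
  have : s ^+ 2 * Normc.normc c ^+ 2 * sqnormn r <= s ^+ 2 * Normc.normc c ^+ 2 * e.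
    by rewrite ler_wpM2l// mulr_ge0// sqr_ge0.
  rewrite -[complex.Re _%:C]/(s * Normc.normc c ^+ 2)%R. lra.
apply/Normc.eq0_normc/eqP; rewrite -sqrf_eq0; set n2 := Normc.normc c ^+ 2.
have n20 : 0 <= n2 by exact: sqr_ge0.
have [//|n2n] := eqVneq n2 0.
have {}n20 : 0 < n2 by rewrite lt0r n2n.
have z0 := sqnormn_ge0 z.
(* With this [s] and e = 1 / s the inequality reads 2 (|z|^2 + 1) <= |z|^2 + (|z|^2 + 1), which is
   absurd. *)
set s := (sqnormn z + 1) / n2.
have s0 : 0 < s by rewrite divr_gt0// ltr_wpDl.
have sn : s * n2 = sqnormn z + 1 by rewrite mulfVK.
have := c2 s s^-1 s0; rewrite invr_gt0 => /(_ s0); rewrite -/n2.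
have -> : s ^+ 2 * n2 * s^-1 = s * n2.
  by field; rewrite gt_eqF.
have -> : 2 * s * n2 = 2 * (s * n2) by rewrite mulrA.
by rewrite sn; lra.
Qed.

(** The choice made by [xget] is forced: the difference of two candidates lies in the kernel and is
    orthogonal to it, hence to itself. *)
Lemma orth_projE : orth_proj kerF x0 = p.
Proof.
apply: xget_unique; first by split; [split|exact: p_orth].
move=> q [[lq Fq] Hq].
have lqp := ell2nB lq p_ell2.
have kqp : kerF (q - p) by split => //; rewrite F_D F_N Fq Fp subrr.
apply/eqP; rewrite -subr_eq0; apply/eqP/sqnormn_eq0 => //.
apply: (@complexI R); rewrite -ell2n_dotxx//.
have -> : ell2n_dot (q - p) (q - p) =
    ell2n_dot (x0 - p) (q - p) - ell2n_dot (x0 - q) (q - p).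
  by rewrite !ell2n_dotBl//; ring.
by rewrite Hq// p_orth// subrr.
Qed.

Lemma cvg_Re_iter_contraction i t :
  (fun k => complex.Re (iter (k + k) S x0 i t)) @ \oo -->
  complex.Re (orth_proj kerF x0 i t).
Proof. by rewrite orth_projE; exact: cvgRe. Qed.

Lemma cvg_Im_iter_contraction i t :
  (fun k => complex.Im (iter (k + k) S x0 i t)) @ \oo -->
  complex.Im (orth_proj kerF x0 i t).
Proof. by rewrite orth_projE; exact: cvgIm. Qed.

End kernel_projection.

(** * Formal operators on square-summable functions *)

Section action.
Variables (R : realType) (m d : nat) (G : groupType) (s : 'I_m -> G).
Local Notation V := ('I_d -> G -> R[i]).

(** [f] embeds the coefficients, so that integer operators and their real contractions act by one
    formula; words act by left translation, as in [lconv]. *)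
Definition fop_act (A : pzRingType) (f : A -> R[i]) (F : fop m d A) (x : V) : V :=
  fun i g => \sum_(p <- F) \sum_j f (p.1 i j) * x j ((word_eval s p.2)^-1 * g)%g.

Lemma fop_act_one (A : pzRingType) (f : {rmorphism A -> R[i]}) x :
  fop_act f (fop_one m d A) x = x.
Proof.
apply/funext => i; apply/funext => g; rewrite /fop_act big_seq1/= word_eval_nil invg1 mul1g.
rewrite (bigD1 i)//= mxE eqxx rmorph1 mul1r big1 ?addr0// => j /negPf ij.
by rewrite mxE eq_sym ij rmorph0 mul0r.
Qed.

Lemma fop_act_mul (A : pzRingType) (f : {rmorphism A -> R[i]}) (F E : fop m d A) x :
  fop_act f (fop_mul F E) x = fop_act f F (fop_act f E x).
Proof.
apply/funext => i; apply/funext => g; rewrite /fop_act /fop_mul big_allpairs_dep.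
apply: eq_bigr => p _ /=; under [RHS]eq_bigr do rewrite mulr_sumr.
rewrite [RHS]exchange_big/=; apply: eq_bigr => q _.
under [RHS]eq_bigr do rewrite mulr_sumr.
rewrite [RHS]exchange_big/=; apply: eq_bigr => j _.
rewrite mxE rmorph_sum mulr_suml; apply: eq_bigr => l _.
by rewrite rmorphM mulrA word_eval_cat invgM mulgA.
Qed.

Lemma fop_act_exp (A : pzRingType) (f : {rmorphism A -> R[i]}) (F : fop m d A) k x :
  fop_act f (fop_exp F k) x = iter k (fop_act f F) x.
Proof.
elim: k => [|k IH]; first exact: fop_act_one.
by rewrite iterS -IH -fop_act_mul.
Qed.

Lemma fop_act_linear (A : pzRingType) (f : A -> R[i]) (F : fop m d A) c x y :
  fop_act f F (vscale c x + y) = vscale c (fop_act f F x) + fop_act f F y.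
Proof.
apply/funext => i; apply/funext => g.
rewrite -[RHS]/(c * fop_act f F x i g + fop_act f F y i g) /fop_act mulr_sumr -big_split.
apply: eq_bigr => p _ /=; rewrite mulr_sumr -big_split; apply: eq_bigr => j _ /=.
set h := ((word_eval s p.2)^-1 * g)%g.
by rewrite -[(_ + y) j h]/(c * x j h + y j h) mulrDr mulrCA.
Qed.

Lemma fop_act0 (A : pzRingType) (f : A -> R[i]) (F : fop m d A) : fop_act f F 0 = 0.
Proof.
apply/funext => i; apply/funext => g; rewrite /fop_act big1// => p _.
by rewrite big1// => j _; rewrite -[(0 : V) j _]/(0 : R[i]) mulr0.
Qed.

Lemma fop_act_contraction (K : R) (F : fop m d int) x :
  fop_act (real_complex R) (fop_contraction K F) x =
  gram_contraction (fop_act intr F) (fop_act intr (fop_adj F)) K x.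
Proof.
have -> : gram_contraction (fop_act intr F) (fop_act intr (fop_adj F)) K x =
  x - vscale K^-1%:C (fop_act intr (fop_mul (fop_adj F) F) x).
  by rewrite /gram_contraction (fop_act_mul (intr : {rmorphism int -> R[i]})).
apply/funext => i; apply/funext => g.
have := fop_act_one (real_complex R) x; move/(congr1 (fun y : V => y i g)).
rewrite /fop_act big_seq1/= => h.
rewrite -[RHS]/(x i g - K^-1%:C * fop_act intr (fop_mul (fop_adj F) F) x i g).
rewrite big_cons/= h; congr (_ + _).
rewrite big_map mulr_sumr -sumrN; apply: eq_bigr => p _ /=.
rewrite mulr_sumr -sumrN; apply: eq_bigr => j _.
by rewrite !mxE mulNr rmorphN mulNr (rmorphM (real_complex R)) rmorph_int mulrA.
Qed.

Let lmul_can (g : G) : cancel (mulg g) (mulg g^-1%g).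
Proof. by move=> h; rewrite mulKg. Qed.

Let lmul_can' (g : G) : cancel (mulg g^-1%g) (mulg g).
Proof. by move=> h; rewrite mulVKg. Qed.

Let lmul_bij (g : G) : bijective (mulg g).
Proof. by exists (mulg g^-1%g). Qed.

Let ell2_term c (f : G -> R[i]) g : ell2 f -> ell2 (fun h => c * f (g * h)%g).
Proof. by move=> lf; apply: ell2Z; exact: (ell2_comp (lmul_bij g)). Qed.

Lemma ell2_sum (I : Type) (r : seq I) (f : I -> G -> R[i]) :
  (forall i, ell2 (f i)) -> ell2 (fun g => \sum_(i <- r) f i g).
Proof.
move=> lf; elim: r => [|i r IH].
  by under eq_fun do rewrite big_nil; exact: ell20.
by under eq_fun do rewrite big_cons; exact: ell2D.
Qed.

Lemma ell2_dot_suml (I : Type) (r : seq I) (f : I -> G -> R[i]) h :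
  (forall i, ell2 (f i)) -> ell2 h ->
  ell2_dot (fun g => \sum_(i <- r) f i g) h = \sum_(i <- r) ell2_dot (f i) h.
Proof.
move=> lf lh; elim: r => [|i r IH].
  have -> : (fun g => \sum_(i <- [::]) f i g) = (fun t : G => 0 * (0 : R[i])).
    by apply/funext => g; rewrite big_nil mul0r.
  rewrite (ell2_dotZl 0 _ lh); last exact: ell20.
  by rewrite mul0r big_nil.
by rewrite big_cons -IH -ell2_dotDl//; [under eq_fun do rewrite big_cons|exact: ell2_sum].
Qed.

Lemma ell2n_fop_act (A : pzRingType) (f : A -> R[i]) (F : fop m d A) x :
  ell2n x -> ell2n (fop_act f F x).
Proof.
move=> lx i; apply: ell2_sum => p; apply: ell2_sum => j.
exact: ell2_term.
Qed.

(** Left translations are unitary and integers are fixed by conjugation, so the formal adjoint is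
    the adjoint for the inner product. *)
Lemma ell2n_dot_fop_act (F : fop m d int) x y : ell2n x -> ell2n y ->
  ell2n_dot (fop_act intr F x) y = ell2n_dot x (fop_act intr (fop_adj F) y).
Proof.
move=> lx ly; have lFy := ell2n_fop_act intr (fop_adj F) ly.
rewrite [RHS]ell2n_dotC// rmorph_sum /ell2n_dot.
have lt (p : 'M[int]_d * word m) i j c (z : V) : ell2n z ->
    ell2 (fun g => c * z j ((word_eval s p.2)^-1 * g)%g).
  by move=> lz; exact: ell2_term.
have step E z w i : ell2n z -> ell2n w -> ell2_dot (fop_act intr E z i) (w i) =
  \sum_(p <- E) \sum_j (p.1 i j)%:~R * ell2_dot (z j \o mulg (word_eval s p.2)^-1%g) (w i).
  move=> lz lw; rewrite ell2_dot_suml => [|p|//]; last first.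
    by apply: ell2_sum => j; exact: ell2_term.
  apply: eq_bigr => p _; rewrite ell2_dot_suml => [|j|//]; last exact: ell2_term.
  apply: eq_bigr => j _; rewrite -ell2_dotZl//.
  exact: (ell2_comp (lmul_bij _)).
under eq_bigr do rewrite step//.
under [RHS]eq_bigr do rewrite step// rmorph_sum.
rewrite exchange_big/= [RHS]exchange_big/= /fop_adj big_map.
apply: eq_bigr => p _ /=; rewrite exchange_big/=; apply: eq_bigr => j _.
rewrite rmorph_sum; apply: eq_bigr => i _.
rewrite mxE rmorphM/= -[conjc _%:~R]/(conjc _) ; congr (_ * _).
  by rewrite (rmorph_int (@conjc R : {rmorphism _ -> _})).
have c1 : ell2 (y i \o mulg (word_eval s p.2)) by apply: ell2_comp.
rewrite word_eval_inv invgK (ell2_dot_comp (lmul_can' _) (lmul_can _))//.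
exact: ell2_dotC.
Qed.

(** By adjunction |F x|^2 = <x, F^* F x>. Hence an integral dimension for the Gram operator is one
    for the kernel of [F]. *)
Lemma ker_fop_gram (F : fop m d int) x : ell2n x ->
  fop_act intr (fop_mul (fop_adj F) F) x = 0 -> fop_act intr F x = 0.
Proof.
move=> lx; rewrite (fop_act_mul (intr : {rmorphism int -> R[i]})) => h.
have lFx := ell2n_fop_act intr F lx.
apply: sqnormn_eq0 => //; apply: (@complexI R).
rewrite -ell2n_dotxx// ell2n_dot_fop_act// h.
have l0 : ell2n (0 : V) by move=> i; exact: ell20.
have := ell2n_dotZr 0 l0 lx; have -> : vscale 0 (0 : V) = 0.
  by apply/funext => i; apply/funext => t; rewrite /vscale mul0r.
by rewrite rmorph0 mul0r.
Qed.

Lemma gram_self_adjoint (F : fop m d int) x y : ell2n x -> ell2n y ->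
  ell2n_dot (fop_act intr (fop_mul (fop_adj F) F) x) y =
  ell2n_dot x (fop_act intr (fop_mul (fop_adj F) F) y).
Proof.
move=> lx ly; rewrite !(fop_act_mul (intr : {rmorphism int -> R[i]})).
have lFx := ell2n_fop_act intr F lx; have lFy := ell2n_fop_act intr F ly.
have lFFx := ell2n_fop_act intr (fop_adj F) lFx.
by rewrite -ell2n_dot_fop_act// [LHS]ell2n_dotC// -ell2n_dot_fop_act// -ell2n_dotC.
Qed.

Lemma gram_ge0 (F : fop m d int) x : ell2n x ->
  0 <= ell2n_dot (fop_act intr (fop_mul (fop_adj F) F) x) x.
Proof.
move=> lx; rewrite gram_self_adjoint// (fop_act_mul (intr : {rmorphism int -> R[i]})).
have lFx := ell2n_fop_act intr F lx.
by rewrite -ell2n_dot_fop_act// ell2n_dotxx// ler0c sqnormn_ge0.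
Qed.

End action.

(** The constant is fixed before [T] and [f]: adding a term with scalar [c i] replaces K by 2 |c
    i|^2 + 2 K. *)
Lemma sqnorm_sum_bound (R : realType) (I : Type) (r : seq I) (c : I -> R[i]) :
  exists2 K : R, 0 <= K & forall (T : choiceType) (f : I -> T -> R[i]) (M : R),
    (forall i, ell2 (f i)) -> (forall i, sqnorm (f i) <= M) -> 0 <= M ->
    ell2 (fun t => \sum_(i <- r) c i * f i t) /\
    sqnorm (fun t => \sum_(i <- r) c i * f i t) <= K * M.
Proof.
elim: r => [|i r [K K0 IH]].
  exists 0 => // T f M _ _ _; rewrite mul0r; apply: ell2_bound => s _.
  by rewrite big1// => t _; rewrite big_nil Normc.normc0 expr0n.
exists (2 * Normc.normc (c i) ^+ 2 + 2 * K).
  by rewrite addr_ge0// mulr_ge0// sqr_ge0.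
move=> T f M lf fM M0; have [lr rM] := IH T f M lf fM M0.
have [] := sqnorm_Dle (ell2Z (c i) (lf i)) lr.
have -> : (fun t => \sum_(j <- i :: r) c j * f j t) =
    (fun t => c i * f i t + \sum_(j <- r) c j * f j t).
  by apply/funext => t; rewrite big_cons.
move=> l1 l2; split => //; apply: (le_trans l2); rewrite [leRHS]mulrDl.
rewrite sqnormZ//; apply: lerD; last by rewrite -mulrA ler_wpM2l.
by rewrite -[leRHS]mulrA; do 2 apply: ler_wpM2l => //; exact: sqr_ge0.
Qed.

(* The bound must not depend on the group: it is shared by the whole sequence. *)
Lemma fop_act_bound (R : realType) (m d : nat) (F : fop m d int) :
  exists2 K : R, 0 <= K & forall (G : groupType) (s : 'I_m -> G)
    (x : 'I_d -> G -> R[i]), ell2n x ->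
    sqnormn (fop_act s intr F x) <= K * sqnormn x.
Proof.
pose r := [seq (p, j) | p <- F, j <- index_enum 'I_d].
have /choice[K HK] : forall i : 'I_d, exists K : R, 0 <= K /\
    forall (T : choiceType) (f : ('M[int]_d * word m) * 'I_d -> T -> R[i]) (M : R),
    (forall q, ell2 (f q)) -> (forall q, sqnorm (f q) <= M) -> 0 <= M ->
    ell2 (fun t => \sum_(q <- r) (q.1.1 i q.2)%:~R * f q t) /\
    sqnorm (fun t => \sum_(q <- r) (q.1.1 i q.2)%:~R * f q t) <= K * M.
  move=> i; have [K K0 HK] := sqnorm_sum_bound r (fun q => (q.1.1 i q.2)%:~R : R[i]).
  by exists K.
exists (\sum_i K i); first by apply: sumr_ge0 => i _; case: (HK i).
move=> G s x lx; rewrite mulr_suml; apply: ler_sum => i _.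
have [_ {}HK] := HK i.
pose f (q : ('M[int]_d * word m) * 'I_d) : G -> R[i] :=
  x q.2 \o mulg (word_eval s q.1.2)^-1%g.
have be (g : G) : bijective (mulg g).
  by exists (mulg g^-1%g) => h; rewrite ?mulKg ?mulVKg.
have -> : fop_act s intr F x i = (fun t => \sum_(q <- r) (q.1.1 i q.2)%:~R * f q t).
  by apply/funext => g; rewrite /fop_act /r big_allpairs_dep.
have [] // := HK G f (sqnormn x) _ _ (sqnormn_ge0 x).
  by move=> q; apply: ell2_comp.
move=> q; rewrite sqnorm_comp// /sqnormn (bigD1 q.2)//= lerDl sumr_ge0// => j _.
exact: sqnorm_ge0.
Qed.

(** * The von Neumann dimension as a limit of traces *)

Section kernel_dimension.
Variables (R : realType) (m d : nat) (G : groupType) (s : 'I_m -> G).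

(** The vector that [entry] feeds to an operator when the trace is computed. *)
Definition basis_vec (j : 'I_d) : 'I_d -> G -> R[i] :=
  fun k => if k == j then @delta1 R G else 0.

Lemma basis_vecE j k g : basis_vec j k g = ((k == j) && (g == 1%g))%:R.
Proof. by rewrite /basis_vec; case: eqP. Qed.

Lemma ell2n_basis_vec j : ell2n (basis_vec j).
Proof.
move=> i; rewrite /basis_vec; case: eqP => _; first exact: ell2_delta.
exact: ell20.
Qed.

Lemma fop_act_basis_vec (A : pzRingType) (f : {rmorphism A -> R[i]}) (F : fop m d A) i j :
  fop_act s f F (basis_vec j) i 1%g =
  \sum_(p <- F) f (p.1 i j) *+ (word_eval s p.2 == 1%g).
Proof.
apply: eq_bigr => p _; rewrite (bigD1 j)//= big1 ?addr0.
  by rewrite basis_vecE eqxx mulg1 invg_eq1 mulr_natr.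
by move=> k /negPf kj; rewrite basis_vecE kj mulr0.
Qed.

Lemma dim_kernelE (D : 'M[group_ringZ G]_d) :
  dim_kernel R D = \sum_i orth_proj (kernel_op D) (basis_vec i) i 1%g.
Proof. by apply: eq_bigr => i _; rewrite /trG /delta1 ell2_dot_delta. Qed.

Lemma cvg_sum_fin (I : Type) (r : seq I) (u : I -> nat -> R) (l : I -> R) :
  (forall i, u i @ \oo --> l i) ->
  (fun k => \sum_(i <- r) u i k) @ \oo --> \sum_(i <- r) l i.
Proof.
move=> ul; elim: r => [|i r IH].
  by rewrite big_nil; under eq_fun do rewrite big_nil; exact: cvg_cst.
by rewrite big_cons; under eq_fun do rewrite big_cons; exact: cvgD.
Qed.

Variables (F : fop m d int) (K : R).
Hypothesis K0 : 0 < K.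
Hypothesis F_bound : forall x : 'I_d -> G -> R[i], ell2n x ->
  sqnormn (fop_act s intr F x) <= K * sqnormn x.
Hypothesis Fa_bound : forall x : 'I_d -> G -> R[i], ell2n x ->
  sqnormn (fop_act s intr (fop_adj F) x) <= K * sqnormn x.

Let tr k := fop_trace s (fop_exp (fop_contraction K F) (k + k)).

(** [D] enters through its kernel only. The same [F] can therefore serve the given matrix over the
    limit group and a Gram matrix over an approximant. *)
Lemma dim_kernel_limit (D : 'M[group_ringZ G]_d) :
  kernel_op (R := R) D = [set x | ell2n x /\ fop_act s intr F x = 0] ->
  dim_kernel R D = (complex.Re (dim_kernel R D))%:C /\
  tr @ \oo --> complex.Re (dim_kernel R D).
Proof.
move=> kD.
pose S := gram_contraction (fop_act s intr F) (fop_act s intr (fop_adj F)) K.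
have trE k : (tr k)%:C = \sum_i iter (k + k) S (basis_vec i) i 1%g.
  have E i : iter (k + k) S (basis_vec i) =
      fop_act s (real_complex R) (fop_exp (fop_contraction K F) (k + k)) (basis_vec i).
    rewrite fop_act_exp; elim: (k + k)%N => //= n ->.
    by rewrite fop_act_contraction.
  under eq_bigr do rewrite E fop_act_basis_vec.
  rewrite exchange_big/= rmorph_sum; apply: eq_bigr => p _.
  by rewrite rmorphMn rmorph_sum/= -sumrMnl.
have cv i := cvg_Re_iter_contraction K0 (ell2n_fop_act s intr F)
  (ell2n_fop_act s intr (fop_adj F)) (fop_act_linear s intr F)
  (fop_act0 s intr (fop_adj F)) (ell2n_dot_fop_act s F) F_bound Fa_bound
  (ell2n_basis_vec i) (i := i) (t := 1%g).
have cv' i := cvg_Im_iter_contraction K0 (ell2n_fop_act s intr F)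
  (ell2n_fop_act s intr (fop_adj F)) (fop_act_linear s intr F)
  (fop_act0 s intr (fop_adj F)) (ell2n_dot_fop_act s F) F_bound Fa_bound
  (ell2n_basis_vec i) (i := i) (t := 1%g).
have ReS (I : Type) (r : seq I) (z : I -> R[i]) :
    complex.Re (\sum_(i <- r) z i) = \sum_(i <- r) complex.Re (z i).
  by elim/big_rec2: _ => //= i x y _ <-; case: (z i) y => [? ?] [? ?].
have ImS (I : Type) (r : seq I) (z : I -> R[i]) :
    complex.Im (\sum_(i <- r) z i) = \sum_(i <- r) complex.Im (z i).
  by elim/big_rec2: _ => //= i x y _ <-; case: (z i) y => [? ?] [? ?].
split; last first.
  have -> : tr = fun k => \sum_i complex.Re (iter (k + k) S (basis_vec i) i 1%g).
    by apply/funext => k; rewrite -ReS -trE.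
  rewrite dim_kernelE ReS kD.
  exact: (@cvg_sum_fin _ _ (fun i k => complex.Re (iter (k + k) S (basis_vec i) i 1%g))).
apply/eqP; rewrite eq_complex/= eqxx/=; apply/eqP.
(* The traces are real, so this sequence is constantly 0, and so is its limit. *)
have c0 : (fun k => \sum_i complex.Im (iter (k + k) S (basis_vec i) i 1%g)) @ \oo -->
    complex.Im (dim_kernel R D).
  rewrite dim_kernelE ImS kD.
  exact: (@cvg_sum_fin _ _ (fun i k => complex.Im (iter (k + k) S (basis_vec i) i 1%g))).
have := cvg_lim (@Rhausdorff R) c0.
have -> : (fun k => \sum_i complex.Im (iter (k + k) S (basis_vec i) i 1%g)) = fun=> 0.
  by apply/funext => k; rewrite -ImS -trE.
by rewrite lim_cst => [<-|].
Qed.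

End kernel_dimension.

(** * Passing between matrices over the group ring and formal operators *)

Section group_ring_matrices.
Variables (R : realType) (m d : nat) (G : groupType) (s : 'I_m -> G).

(** Distinct words may have the same value in [G], so their coefficients are collected. *)
Definition fop_group_ring (E : fop m d int) : 'M[group_ringZ G]_d :=
  \matrix_(i, j) [fsfun g in [fset g | g in [seq word_eval s p.2 | p <- E]]%fset =>
    \sum_(p <- E) p.1 i j *+ (word_eval s p.2 == g)].

Lemma lconv_supset (a : group_ringZ G) (U : {fset G}) (f : G -> R[i]) g :
  (finsupp a `<=` U)%fset ->
  lconv a f g = \sum_(h <- U) (a h)%:~R * f (h^-1 * g)%g.
Proof.
move=> aU; rewrite /lconv; apply: big_fset_incl => // h _ ha.
by rewrite fsfun_dflt// mul0r.
Qed.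

Lemma mxop_fop_group_ring (E : fop m d int) (x : 'I_d -> G -> R[i]) :
  mxop (fop_group_ring E) x = fop_act s intr E x.
Proof.
apply/funext => i; apply/funext => g.
have sumE (I : Type) (r : seq I) (z : I -> G -> R[i]) :
    (\sum_(j <- r) z j) g = \sum_(j <- r) z j g.
  by elim/big_rec2: _ => // j x' y' _ <-.
rewrite /mxop sumE /fop_act exchange_big/=; apply: eq_bigr => j _.
set U := [fset h | h in [seq word_eval s p.2 | p <- E]]%fset.
rewrite (@lconv_supset _ U); last by rewrite mxE; exact: finsupp_sub.
rewrite (eq_big_seq (fun h => \sum_(p <- E)
  (p.1 i j)%:~R *+ (word_eval s p.2 == h) * x j (h^-1 * g)%g)); last first.
  move=> h hU; rewrite mxE fsfunE hU rmorph_sum mulr_suml.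
  by apply: eq_bigr => p _; rewrite rmorphMn.
rewrite exchange_big/= big_seq [RHS]big_seq; apply: eq_bigr => p pE.
rewrite (bigD1_seq (word_eval s p.2))/=; last 2 first.
- by rewrite !inE/=; apply/mapP; exists p.
- exact: fset_uniq.
rewrite eqxx mulr1n big1 ?addr0// => h /negPf; rewrite eq_sym => ->.
by rewrite mulr0n mul0r.
Qed.

(** One term for each element of the union of the supports of the entries, with a chosen word that
    represents it. *)
Lemma mxop_fop (D : 'M[group_ringZ G]_d) : (forall g, exists w, word_eval s w = g) ->
  exists F : fop m d int, forall x : 'I_d -> G -> R[i], mxop D x = fop_act s intr F x.
Proof.
move=> /choice[w wE].
pose U := (\bigcup_(ij <- enum {: 'I_d * 'I_d}) finsupp (D ij.1 ij.2))%fset.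
exists [seq (\matrix_(i, j) D i j g, w g) | g <- U] => x.
apply/funext => i; apply/funext => g.
have sumE (I : Type) (r : seq I) (z : I -> G -> R[i]) :
    (\sum_(j <- r) z j) g = \sum_(j <- r) z j g.
  by elim/big_rec2: _ => // j x' y' _ <-.
rewrite /mxop sumE /fop_act big_map exchange_big/=; apply: eq_bigr => j _.
rewrite (@lconv_supset _ U); last by apply: (@bigfcup_sup _ _ _ (i, j)); rewrite ?mem_enum.
by apply: eq_bigr => h _; rewrite mxE wE.
Qed.

End group_ring_matrices.

(** * Convergence of marked groups *)

(** The delicate case is distance 0 by default, without an agreement radius. A shortest word of
    disagreement cannot be empty, since the empty word is a relation everywhere, and its length
    minus 1 would be an agreement radius. *)
Lemma marked_dist_lt (R : realType) (m : nat) (X Y : markedGroup m) (r : nat) :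
  marked_dist R X Y < 2^-1 ^+ r ->
  forall w : word m, (size w <= r)%N -> relation_in X w <-> relation_in Y w.
Proof.
rewrite /marked_dist; case: pselect => [h|h] /= dlt w wr.
  set r0 := [get r | _] in dlt.
  have [agree _] : agreement_radius X Y r0 by case: (h) => r1 h1; exact: (getI h1).
  apply: agree; apply: (leq_trans wr); rewrite leqNgt; apply/negP => r0r.
  move: dlt; apply/negP; rewrite -leNgt ler_wiXn2l//; first lra.
  exact: ltnW.
apply: contrapT => nw.
pose P n := `[< exists2 v : word m, size v = n &
  ~ (relation_in X v <-> relation_in Y v) >].
have exP : exists n, P n by exists (size w); apply/asboolP; exists w.
have [v vn nv] : exists2 v : word m, size v = ex_minn exP &
    ~ (relation_in X v <-> relation_in Y v) by case: ex_minnP => n /asboolP.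
move: vn; case: ex_minnP => -[|n] Pn minn vn.
  by apply: nv; case: v vn => // _; rewrite /relation_in !word_eval_nil.
apply: h; exists n; split; last by exists v.
move=> u un; apply: contrapT => nu.
have /minn : P (size u) by apply/asboolP; exists u.
by rewrite ltnNge un.
Qed.

Lemma fop_trace_relations (A : pzRingType) (m d : nat) (X Y : markedGroup m)
    (F : fop m d A) :
  (forall w : word m, (size w <= \max_(p <- F) size p.2)%N ->
     relation_in X w <-> relation_in Y w) ->
  fop_trace (@marked_gen m X) F = fop_trace (@marked_gen m Y) F.
Proof.
move=> H; rewrite /fop_trace big_seq [RHS]big_seq; apply: eq_bigr => p pF.
congr (_ *+ _); congr nat_of_bool.
have hp : (size p.2 <= \max_(q <- F) size q.2)%N by rewrite (big_rem p)// leq_maxl.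
by apply/eqP/eqP => h; apply/(H _ hp).
Qed.

(** * The limit argument *)

(** Two integers less than 1 apart coincide, so the integer found within 1/4 of [t] is also the one
    found for every smaller [e]. *)
Lemma int_limit (R : realType) (t : R) :
  (forall e, 0 < e -> exists z : int, `|t - z%:~R| <= e) -> exists z : int, t = z%:~R.
Proof.
move=> H; have [z Hz] := H (1 / 4) ltac:(lra).
exists z; apply/eqP; rewrite -subr_eq0 -normr_le0; apply/ler_addgt0Pr => e e0.
rewrite add0r; have [e4|e4] := leP (1 / 4) e; first exact: (le_trans Hz).
have [z' Hz'] := H e e0.
have zz : `|(z - z')%:~R| < 1 :> R.
  rewrite rmorphB/=; have -> : z%:~R - z'%:~R = (t - z'%:~R) - (t - z%:~R) :> R by ring.
  by apply: le_lt_trans (ler_normB _ _) _; lra.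
have -> : z = z'; last by [].
move: zz; rewrite -intr_norm -[1]/(1%:~R) ltr_int -abszE ltz_nat ltnS leqn0.
by rewrite absz_eq0 subr_eq0 => /eqP.
Qed.

Theorem theorem6 (R : realType) (m : nat) (hm : (0 < m)%N)
    (X : nat -> markedGroup m) (Y : markedGroup m)
    (hlim : (fun n => marked_dist R (X n) Y) @ \oo --> (0 : R))
    (htf : forall n, torsion_free (X n))
    (hsofic : forall n, sofic R (X n))
    (hatiyah : forall n, atiyah_conjecture R (X n)) :
  atiyah_conjecture R Y.
Proof.
move=> d D d0 _ _.
have [F DF] := mxop_fop R D (@marked_genP m Y).
have [K1 K10 HK1] := fop_act_bound R F.
have [K2 K20 HK2] := fop_act_bound R (fop_adj F).
set B := fop_mul (fop_adj F) F.
have B0 : 0 <= (fop_abs B)%:~R :> R.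
  rewrite ler0z; apply: sumr_ge0 => p _; apply: sumr_ge0 => i _.
  by apply: sumr_ge0 => j _.
(* The summands serve, in turn, [0 <= ln K], the bounds for [F] and its adjoint over every group,
   and the eigenvalues in every permutation model. *)
set K : R := 1 + K1 + K2 + (fop_abs B)%:~R.
have Kge1 : 1 <= K by rewrite /K; lra.
have K0 : 0 < K by lra.
have FK (G : groupType) (s : 'I_m -> G) (x : 'I_d -> G -> R[i]) : ell2n x ->
    sqnormn (fop_act s intr F x) <= K * sqnormn x.
  move=> lx; apply: (le_trans (HK1 G s x lx)).
  by rewrite ler_wpM2r ?sqnormn_ge0// /K; lra.
have FaK (G : groupType) (s : 'I_m -> G) (x : 'I_d -> G -> R[i]) : ell2n x ->
    sqnormn (fop_act s intr (fop_adj F) x) <= K * sqnormn x.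
  move=> lx; apply: (le_trans (HK2 G s x lx)).
  by rewrite ler_wpM2r ?sqnormn_ge0// /K; lra.
have kerD : kernel_op (R := R) D =
    [set x | ell2n x /\ fop_act (@marked_gen m Y) intr F x = 0].
  by apply/seteqP; split => x [lx]; [rewrite DF|rewrite -DF] => Dx; split.
have [dimD cvD] := dim_kernel_limit K0 (FK Y _) (FaK Y _) kerD.
suff [z tz] : exists z : int, complex.Re (dim_kernel R D) = z%:~R.
  by exists z; rewrite dimD tz rmorph_int.
apply: int_limit => e e0.
have lnK0 : 0 <= ln K by exact: ln_ge0.
(* Chosen so that the gap obtained with a = e / 3 / c is at most e / 3. *)
set c := 1 + ln K * d%:R.
have c0 : 0 < c by rewrite ltr_pwDl// mulr_ge0.
have e30 : 0 < e / 3 by rewrite divr_gt0.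
have a0 : 0 < e / 3 / c by rewrite divr_gt0.
have [k0 Hk0] := expr_le_ln a0.
have gap : e / 3 / c * ln K * d%:R <= e / 3.
  rewrite -mulrA mulrAC ler_pdivrMr// ler_pM2l// /c; lra.
have /cvgrPdist_le /(_ _ e30) [k1 _ Hk1] := cvD.
(* Large enough for the trace over [Y] to be within e / 3 of the dimension and for the uniform gap
   to apply; the successor makes the threshold positive. *)
pose k := maxn k1 k0.+1.
have {}Hk1 := Hk1 k (leq_maxl _ _).
have k0k : (k0.+1 <= k + k)%N by rewrite (leq_trans (leq_maxr k1 _))// leq_addr.
(* The exponent is fixed before the approximant: [n] only has to match the relations among the words
   of this one power. *)
pose L := (\max_(p <- fop_exp (fop_contraction K F) (k + k)) size p.2)%N.
have [n agree] : exists n, forall w : word m, (size w <= L)%N ->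
    relation_in (X n) w <-> relation_in Y w.
  have p0 : 0 < 2^-1 ^+ L.+1 :> R by rewrite exprn_gt0// invr_gt0.
  have /cvgrPdist_lt /(_ _ p0) [n _ Hn] := hlim; exists n => w wL.
  apply: (@marked_dist_lt R _ _ _ L.+1); last exact: leqW.
  by have := Hn n (leqnn _); rewrite sub0r normrN; exact: le_lt_trans (ler_norm _).
have trE := fop_trace_relations agree.
set s := @marked_gen m (X n) in trE.
(* The Gram formula, evaluated in [X n], is the matrix to which the conjecture for [X n] is
   applied. *)
pose D' := fop_group_ring s B.
have D'E (x : 'I_d -> X n -> R[i]) : mxop D' x = fop_act s intr B x.
  exact: mxop_fop_group_ring.
have [] := hatiyah n d D' d0.
- by move=> x y lx ly; rewrite !D'E; exact: gram_self_adjoint.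
- by move=> x lx; rewrite D'E; exact: gram_ge0.
move=> z dimz; exists z.
have kerD' : kernel_op (R := R) D' = [set x | ell2n x /\ fop_act s intr F x = 0].
  apply/seteqP; split => x [lx] => [|Fx]; first rewrite D'E => Fx.
    by split => //; exact: ker_fop_gram.
  split => //; rewrite D'E.
  by rewrite (fop_act_mul s (intr : {rmorphism int -> R[i]})) Fx fop_act0.
have [_] := dim_kernel_limit K0 (FK _ s) (FaK _ s) kerD'.
rewrite dimz; have -> : complex.Re (z%:~R : R[i]) = z%:~R.
  by rewrite -(rmorph_int (real_complex R)).
move=> cvD'.
(* [l] may depend on [n], but going from [k] to [l] costs at most e / 3 by the uniform gap. The
   three errors add up to [e]. *)
have /cvgrPdist_le /(_ _ e30) [l1 _ Hl1] := cvD'.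
pose l := maxn l1 k.
have {}Hl1 := Hl1 l (leq_maxl _ _).
have kl : (k + k <= l + l)%N by rewrite leq_add// leq_maxr.
have FBK : (fop_abs (fop_mul (fop_adj F) F))%:~R <= K by rewrite -/B /K; lra.
have Hk0' j : (k0.+1 <= j)%N -> forall u : R, 0 < u <= 1 ->
    (1 - u) ^+ j <= e / 3 / c * - ln u.
  by move=> /ltnW; exact: Hk0.
have := fop_trace_gap s (hsofic n) Kge1 FBK a0 (ltn0Sn k0) Hk0' k0k kl.
move: Hk1 Hl1; rewrite /= trE !ler_norml => /andP[? ?] /andP[? ?] /andP[? ?].
by apply/andP; split; lra.
Qed.
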